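(* Let $E$ be a random variable on a probability space $(\Omega,\mathcal{F},\mathbb{P}_1)$ with $\mathbb{P}_1(0<E<\infty)=1$ and $\mu:=\mathbb{E}_{\mathbb{P}_1}[\log E]$ well defined in $(-\infty,+\infty]$. For $c\in\mathbb{R}$ put $$\mathcal{A}_c:=\{Q\ll\mathbb{P}_1:\ \mathbb{E}_Q[\log E]\le c\},\qquad \mathcal{D}(c):=\inf_{Q\in\mathcal{A}_c}\mathrm{KL}(Q\|\mathbb{P}_1),$$ and, with $\Lambda(s):=\log\mathbb{E}_{\mathbb{P}_1}[E^{-s}]\in(-\infty,+\infty]$ for $s\ge0$, $$\mathcal{J}(c):=\sup_{s\ge0}\{-sc-\Lambda(s)\}.$$ Then $\mathcal{J}(c)=\mathcal{D}(c)$ for every $c\in\mathbb{R}$. Write $s_{\max}:=\sup\{s\ge0:\Lambda(s)<\infty\}$; for $s$ with $\Lambda(s)<\infty$ let $Q_s$ be the tilted law $dQ_s:=E^{-s}e^{-\Lambda(s)}d\mathbb{P}_1$ and $m(s):=\mathbb{E}_{Q_s}[\log E]$; and let $x_0:=\mathbb{P}_1\text{-}\operatorname{ess\,inf}\log E\in[-\infty,\infty)$. Then moreover: (a) if $c\ge\mu$ then $\mathcal{J}(c)=\mathcal{D}(c)=0$, attained at $Q=\mathbb{P}_1$; (b) if $c<x_0$ then $\mathcal{A}_c=\emptyset$ and $\mathcal{J}(c)=\mathcal{D}(c)=+\infty$; (c) if $c=x_0>-\infty$ then $\mathcal{J}(c)=\mathcal{D}(c)=\log\frac{1}{\mathbb{P}_1(\log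 E=x_0)}$, and the infimum is attained exactly when $\mathbb{P}_1(\log E=x_0)>0$, with unique minimiser $\mathbb{P}_1(\,\cdot\mid\log E=x_0)$; (d) if $x_0<c<\mu$ and $s_{\max}=0$ (i.e. $\mathbb{E}_{\mathbb{P}_1}[E^{-s}]=\infty$ for every $s>0$), then $\mathcal{J}(c)=\mathcal{D}(c)=0$ and the infimum is not attained; (e) if $x_0<c<\mu$ and $s_{\max}>0$, then the common value lies in $(0,+\infty]$, and the infimum defining $\mathcal{D}(c)$ is attained if and only if $m(s^{\ast})=c$ for some $s^{\ast}$ with $\Lambda(s^{\ast})<\infty$, in which case $Q_{s^{\ast}}$ is the unique minimiser and $\mathcal{D}(c)=\mathrm{KL}(Q_{s^{\ast}}\|\mathbb{P}_1)=-s^{\ast}c-\Lambda(s^{\ast})$.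
   Context: $\log$ is the natural logarithm. $Q$ ranges over probability measures on $(\Omega,\mathcal{F})$ absolutely continuous with respect to $\mathbb{P}_1$; membership in $\mathcal{A}_c$ requires $\mathbb{E}_Q[\log E]$ to be well defined in $[-\infty,\infty]$ and at most $c$. $\mathrm{KL}(Q\|\mathbb{P}_1)=\mathbb{E}_Q[\log\frac{dQ}{d\mathbb{P}_1}]\in[0,\infty]$ is the relative entropy. Conventions: $\inf\emptyset:=+\infty$, $\log\frac10:=+\infty$; terms with $\Lambda(s)=+\infty$ contribute $-\infty$ to the supremum. *)

(* Defs.v *)
From HB Require Import structures.
From mathcomp Require Import all_boot all_order all_algebra.
From mathcomp Require Import all_classical all_reals all_analysis.
From mathcomp Require Import measurable_realfun measurable_fun_approximation.
From mathcomp Require Import ess_sup_inf.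

Set Implicit Arguments.
Unset Strict Implicit.
Unset Printing Implicit Defensive.
Import Order.TTheory GRing.Theory Num.Theory.
Local Open Scope classical_set_scope.
Local Open Scope ring_scope.
Local Open Scope charge_scope.
Local Open Scope ereal_scope.

Section prelim.
Context {d : measure_display} {T : measurableType d} {R : realType}.

(* The library integral is total (it returns -oo for the form oo - oo), so that
   the existence of an expectation in [-oo, +oo] has to be required. *)
Definition expectation_defined (Q : {measure set T -> \bar R})
    (f : T -> \bar R) : Prop :=
  \int[Q]_x f^\+ x < +oo \/ \int[Q]_x f^\- x < +oo.

(* Only meant for Q `<< P. The negative part of log dQ/dP is always
   Q-integrable, hence no oo - oo arises and the value lies in [0, +oo]. *)
Definition KL (Q P : probability T R) : \bar R :=
  \int[Q]_x lne (('d (charge_of_finite_measure Q) '/d P) x).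

Lemma measurable_lne : measurable_fun setT (@lne R : \bar R -> \bar R).
Proof.
have -> : @lne R = fun x => if x <= 0 then -oo else
    if x == +oo then +oo else (ln (fine x))%:E.
  by apply/funext => -[r| |] //=; rewrite ?leNye.
apply: (@measurable_fun_ifT _ _ _ _ (cst -oo)) => //=; first exact: measurable_fun_lee.
apply: measurable_fun_ifT => //=; first exact: measurable_fun_eqe.
apply/measurable_EFinP; apply: measurableT_comp; first exact: measurable_ln.
exact: fine_measurable.
Qed.

End prelim.

Section tilting.
Context {d : measure_display} {T : measurableType d} {R : realType}.
Variables (P : probability T R) (E : {RV P >-> \bar R}).

(* lne 0 = -oo and lne +oo = +oo. The values of lne (E x) and E x `^ (- s) at
   the points where E x is not in ]0, +oo[ are irrelevant: those points will
   form a P-null set. *)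
Definition logE (x : T) : \bar R := lne (E x).

Definition Lambda (s : R) : \bar R := lne (\int[P]_x (E x `^ (- s))).

Definition admissible (c : R) : set (probability T R) :=
  [set Q : probability T R |
    [/\ Q `<< P, expectation_defined Q logE & \int[Q]_x logE x <= c%:E]].

Definition Dinf (c : R) : \bar R :=
  ereal_inf [set KL Q P | Q in admissible c].

Definition Jsup (c : R) : \bar R :=
  ereal_sup [set (- s * c)%:E - Lambda s | s in [set s | (0 <= s)%R]].

Definition minimizer (c : R) (Q : probability T R) : Prop :=
  admissible c Q /\ KL Q P = Dinf c.

(* Measures are functions on all subsets of T; two of them are identified when
   they agree on the measurable ones. *)
Definition unique_minimizer (c : R) (Q : probability T R) : Prop :=
  minimizer c Q /\
  forall Q', minimizer c Q' -> forall A, measurable A -> Q' A = Q A.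

Definition s_max : \bar R :=
  ereal_sup [set s%:E | s in [set s | (0 <= s)%R /\ Lambda s < +oo]].

Definition tilted_measure (s : R) (A : set T) : \bar R :=
  \int[P]_(x in A) (E x `^ (- s) * expeR (- Lambda s)).

Lemma measurable_logE : measurable_fun [set: T] logE.
Proof. exact: measurableT_comp measurable_lne _. Qed.

Lemma measurable_tilt (s : R) : measurable_fun [set: T] (fun x => E x `^ (- s)).
Proof. exact: measurableT_comp (measurable_poweR _) _. Qed.

Let tilted0 s : tilted_measure s set0 = 0.
Proof. exact: integral_set0. Qed.

Let tilted_ge0 s A : 0 <= tilted_measure s A.
Proof.
by apply: integral_ge0 => x _; rewrite mule_ge0 ?poweR_ge0 ?expeR_ge0.
Qed.

Let tilted_sigma_additive s : semi_sigma_additive (tilted_measure s).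
Proof.
apply: semi_sigma_additive_nng_induced.
  by apply: emeasurable_funM => //; exact: measurable_tilt.
by move=> x; rewrite mule_ge0 ?poweR_ge0 ?expeR_ge0.
Qed.

HB.instance Definition _ s := isMeasure.Build _ _ _ (tilted_measure s)
  (tilted0 s) (@tilted_ge0 s) (@tilted_sigma_additive s).

(* The normalization only serves to have a probability measure for every s: it
   is vacuous as soon as Lambda s < +oo, see tilted_lawE. *)
Definition tilted_law (s : R) : probability T R :=
  mnormalize (tilted_measure s) P.

Definition tilted_mean (s : R) : \bar R := \int[tilted_law s]_x logE x.

Definition x0 : \bar R := ess_inf P logE.

Definition x0_event : set T := [set x | logE x = x0].

Lemma measurable_x0_event : measurable x0_event.
Proof.
rewrite (_ : x0_event = logE @^-1` [set x0])// -[X in measurable X]setTI.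
exact: measurable_logE.
Qed.

(* The law P( . | log E = x0); it is P itself when the event is null. *)
Definition x0_law : probability T R :=
  mnormalize (mrestr P measurable_x0_event) P.

Lemma x0_lawE : 0 < P x0_event ->
  forall A, measurable A -> x0_law A = P (A `&` x0_event) / P x0_event.
Proof.
move=> P0 A mA; have Pf := fin_num_measure P _ measurable_x0_event.
rewrite /x0_law/= /mnormalize/= /mrestr/= setTI.
rewrite ifF; last by rewrite gt_eqF//= lt_eqF// ltey_eq Pf.
by rewrite -[in RHS](fineK Pf) inver ifF// fine_eq0 ?gt_eqF.
Qed.

Hypothesis E01 : P [set x | 0 < E x < +oo] = 1.

Let ae_E01 : P.-negligible (~` [set x | 0 < E x < +oo]).
Proof.
have mE : measurable [set x | 0 < E x < +oo].
  rewrite (_ : [set x | _] = E @^-1` [set` Interval (BRight 0) (BLeft +oo)]); last first.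
    by apply/seteqP; split => x /=; rewrite in_itv.
  exact: (measurable_funPTI E (emeasurable_itv _)).
apply/negligibleP; first exact: measurableC.
by have := probability_setC P mE; rewrite E01 subee.
Qed.

Let tilt_gt0 s : 0 < \int[P]_x (E x `^ (- s)).
Proof.
rewrite lt_neqAle integral_ge0 ?andbT//; last by move=> *; exact: poweR_ge0.
apply/eqP => I0.
have /ae_eq_integral_abs : measurable_fun setT (fun x => E x `^ (- s)).
  exact: measurable_tilt.
move=> /(_ P measurableT)[+ _]; case.
  by rewrite I0; apply: eq_integral => x _; rewrite gee0_abs ?poweR_ge0.
move=> N [mN N0 subN].
have : P setT = 0.
  apply/negligibleP => //.
  have -> : [set: T] = N `|` ~` [set x | 0 < E x < +oo].
    apply/esym/seteqP; split => // x _; have [|] := pselect (0 < E x < +oo).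
      move=> /andP[Ex _]; left; apply: subN => /=.
      by move=> /(_ I) /eqP; rewrite gt_eqF// poweR_gt0.
    by right.
  by apply: negligibleU => //; apply/negligibleP.
by rewrite probability_setT => /eqP; rewrite onee_eq0.
Qed.

Lemma Lambda_gtNy s : -oo < Lambda s.
Proof.
rewrite /Lambda; move: (tilt_gt0 s); case: integral => [r| |]//=.
by rewrite lte_fin => r0; rewrite leNgt r0/= ltNyr.
Qed.

Lemma tilted_lawE s : Lambda s < +oo ->
  forall A, measurable A ->
  tilted_law s A = \int[P]_(x in A) (E x `^ (- s) * expeR (- Lambda s)).
Proof.
move=> Ls A mA.
suff M1 : tilted_measure s setT = 1.
  by rewrite /tilted_law/= /mnormalize/= M1 onee_eq0/= invr1 mule1.
rewrite /tilted_measure ge0_integralZr//; last 3 first.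
- exact: measurable_tilt.
- by move=> x _; exact: poweR_ge0.
- exact: expeR_ge0.
move: Ls (tilt_gt0 s); rewrite /Lambda; case: integral => [r| |]//= + r0.
rewrite lte_fin in r0; rewrite leNgt r0/= => _.
by rewrite expRN lnK ?posrE// -EFinM divff// gt_eqF.
Qed.

End tilting.

(* Main.v *)
From HB Require Import structures.
Require Import Defs.
From mathcomp Require Import all_boot all_order all_algebra.
From mathcomp Require Import all_classical all_reals all_analysis.
From mathcomp Require Import measurable_realfun ess_sup_inf.
From mathcomp Require Import ring lra.

(* Weak duality is Gibbs' inequality: for a density q = dQ/dP and e^h with mass
   at most 1 under P, integrate h - ln q <= e^h / q - 1 against Q; equality
   forces q = e^h, which yields all the uniqueness claims (h = - s log E -
   Lambda(s), or h = - log P(log E = x0) on the event {log E = x0}).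

   Strong duality for x0 < c < mu: put Y = log E - c and restrict P to the strips
   |Y| <= n, where every exponential moment is finite. The intermediate value
   theorem gives s_n with mean of Y zero under the tilted law, all s_n lying in
   one compact interval because P(Y < 0) > 0. These tilted laws are admissible,
   and at a cluster point s of the s_n monotone convergence gives
   E[exp(- s Y)] <= exp(- D(c)). So the dual supremum is attained at s and equals
   D(c); a primal minimiser must then be the tilted law Q_s, and complementary
   slackness gives m(s) = c. *)

Set Implicit Arguments.
Unset Strict Implicit.
Unset Printing Implicit Defensive.
Import Order.TTheory GRing.Theory Num.Theory.
Import numFieldNormedType.Exports.
Local Open Scope classical_set_scope.
Local Open Scope ring_scope.
Local Open Scope ereal_scope.

(** Under [P] itself, [exp(- s Y)] may have infinite mean for every [s > 0], or the tilted mean may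
    stay above [c] up to [s_max]; then no tilted law of [P] has mean [c], and the primal infimum is
    not attained. The strips provide admissible competitors regardless. [P] is restricted to a strip
    without renormalising: with [f] the integral of [exp(- s_n Y)] over the strip, the entropy of
    the tilted law relative to [P] is exactly [- ln f], and for a fixed exponent these integrals
    grow with the strip, which makes the monotone limit possible.

    Compactness of the [s_n] is lost at [c = x0], where [P(Y < 0) = 0]; the dual value there is the
    limit of the terms at [s = n]. Below [x0] the dual terms grow at least linearly in [s].

    Attainment at some [s] does not say whether [s > 0]. In regime (d) only [s = 0] is possible; in
    regime (e) strict positivity comes from the Laplace transform of [Y] dropping below 1 just to
    the right of 0, its slope there being minus the mean of [Y]. *)

Lemma measfun_EFin {d : measure_display} {T : measurableType d}
    {R : realType} (f : T -> R) (D : set T) :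
  measurable_fun setT f -> measurable_fun D (fun x => (f x)%:E).
Proof. by move=> mf; exact/measurable_EFinP/measurable_funTS. Qed.

(** * Extended-real integrals and almost-sure statements *)

Section integral_facts.
Context {d : measure_display} {T : measurableType d} {R : realType}.
Variable m : {measure set T -> \bar R}.
Variables (D : set T) (mD : measurable D).
Implicit Types f g : T -> \bar R.

(* No integrability is needed because the integral takes oo - oo to -oo. *)
Lemma le_integral_ext f g : measurable_fun D f -> measurable_fun D g ->
  (forall x, D x -> f x <= g x) ->
  \int[m]_(x in D) f x <= \int[m]_(x in D) g x.
Proof.
move=> mf mg fg; rewrite integralE// [leRHS]integralE//.
apply: leeB; apply: ge0_le_integral => //.
- exact: measurable_funepos.
- exact: measurable_funepos.
- by move=> x Dx; rewrite !funeposE ge_max !le_max fg//= lexx orbT.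
- exact: measurable_funeneg.
- exact: measurable_funeneg.
- by move=> x Dx; rewrite !funenegE ge_max !le_max lexx orbT andbT leeN2 fg.
Qed.

Lemma integrable_neg_lty f : measurable_fun D f ->
  \int[m]_(x in D) f^\- x < +oo -> \int[m]_(x in D) f x < +oo ->
  m.-integrable D f.
Proof.
move=> mf fn; rewrite integralE => fl.
apply/integrableP; split => //.
have n0 : 0 <= \int[m]_(x in D) f^\- x by exact: integral_ge0.
have p0 : 0 <= \int[m]_(x in D) f^\+ x by exact: integral_ge0.
rewrite (_ : (fun x => `|f x|) = f^\+ \+ f^\-); last exact: fune_abse.
rewrite ge0_integralD//; last 2 first.
- exact: measurable_funepos.
- exact: measurable_funeneg.
apply: lte_add_pinfty => //.
by move: fn n0 p0 fl; do 2 case: integral => [?| |] //=; rewrite ?ltry.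
Qed.

(** An infinite negative part would make the integral [-oo] whatever the positive part is, so a
    finite value already bounds both parts. *)
Lemma integrable_fin_integral f : measurable_fun D f ->
  \int[m]_(x in D) f x \is a fin_num -> m.-integrable D f.
Proof.
move=> mf fint; apply: integrable_neg_lty => //; last first.
  by rewrite ltey_eq fint.
move: fint; rewrite integralE ltey.
by case: (\int[m]_(x in D) f^\- x) => //; case: integral.
Qed.

End integral_facts.

Section ae_facts.
Context {d : measure_display} {T : measurableType d} {R : realType}.

Lemma null_dominates_ae (Q P : {measure set T -> \bar R}) (S : T -> Prop) :
  Q `<< P -> {ae P, forall x, S x} -> {ae Q, forall x, S x}.
Proof.
by move=> /null_content_dominatesP QP [N [mN N0 sN]]; exists N; split => //; exact: QP.
Qed.

Lemma prob1_negligible (P : probability T R) (A : set T) : measurable A ->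
  P A = 1 -> P (~` A) = 0.
Proof. by move=> mA PA; rewrite probability_setC// PA subee. Qed.

Lemma prob1_integral (P : probability T R) (A : set T) (f : T -> \bar R) :
  measurable A -> measurable_fun setT f -> P A = 1 ->
  \int[P]_x f x = \int[P]_(x in A) f x.
Proof.
move=> mA mf PA.
rewrite [RHS]integral_mkcond; apply: ae_eq_integral => //.
  exact/(measurable_restrictT _ mA)/measurable_funTS.
exists (~` A); split; [exact: measurableC|exact: prob1_negligible|].
move=> x /= + Ax; apply => _; rewrite patchE mem_set//.
Qed.

Lemma prob_integral_cst_in (P : probability T R) (A : set T) (r : R) :
  measurable A -> \int[P]_(x in A) r%:E = r%:E * P A.
Proof. by move=> mA; exact: integral_cst. Qed.

Lemma prob_integral_cst (P : probability T R) (r : R) : \int[P]_x r%:E = r%:E.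
Proof. by rewrite prob_integral_cst_in// probability_setT mule1. Qed.

Lemma prob1I (P : probability T R) (A B : set T) : measurable A -> measurable B ->
  P A = 1 -> P (B `&` A) = P B.
Proof.
move=> mA mB PA.
rewrite [RHS](measureDI P mB mA) [X in X + _](_ : _ = 0) ?add0e//.
apply/eqP; rewrite -measure_le0 -(prob1_negligible mA PA).
apply: le_measure; rewrite ?inE; [exact: measurableD|exact: measurableC|by move=> x []].
Qed.

End ae_facts.

(** * Laws with an exponential density on an event *)

Section density.
Context {d : measure_display} {T : measurableType d} {R : realType}.
Variables (P : probability T R).

(** The zeros of the density are moved into the complement of [A], so that the log-density [h] is a
    real function and [ln 0] never occurs. Tilted laws, tilted laws on a strip and conditioning on
    an event all have this form. *)
Definition has_density (Q : set T -> \bar R) (A : set T) (h : T -> R) :=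
  forall B, measurable B -> Q B = \int[P]_(x in B `&` A) (expR (h x))%:E.

Section exp_measure.
Variables (A : set T) (h : T -> R).
Hypotheses (mA : measurable A) (mh : measurable_fun setT h).

Let mexp B : measurable_fun B (fun x => (expR (h x))%:E).
Proof. exact/measurable_EFinP/measurable_funTS/measurableT_comp. Qed.

(* The two proofs are arguments only for the measure structure to be inferable. *)
Definition exp_measure of measurable A & measurable_fun setT h := fun B : set T =>
  \int[P]_(x in B) (((fun x => (expR (h x))%:E) \_ A) x).

Arguments exp_measure : simpl never.

Local Notation nu := (exp_measure mA mh).

Let f0 x : 0 <= ((fun x => (expR (h x))%:E) \_ A) x.
Proof. by apply: erestrict_ge0 => *; rewrite lee_fin expR_ge0. Qed.

Let nu0 : nu set0 = 0. Proof. exact: integral_set0. Qed.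
Let nu_ge0 B : 0 <= nu B. Proof. exact: integral_ge0. Qed.
Let nu_sigma_additive : semi_sigma_additive nu.
Proof.
apply: semi_sigma_additive_nng_induced => //.
exact/(measurable_restrictT _ mA).
Qed.

HB.instance Definition _ := isMeasure.Build _ _ _ nu nu0 nu_ge0 nu_sigma_additive.

Lemma exp_measureE B : nu B = \int[P]_(x in B `&` A) (expR (h x))%:E.
Proof. by rewrite [RHS]integral_mkcondr. Qed.

Lemma has_density_exists : \int[P]_(x in A) (expR (h x))%:E = 1 ->
  exists Q : probability T R, has_density Q A h.
Proof.
move=> A1; exists (mnormalize nu P) => B mB.
have nuT : nu setT = 1 by rewrite exp_measureE setTI.
by rewrite /= /mnormalize/= nuT onee_eq0/= invr1 mule1 exp_measureE.
Qed.

End exp_measure.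

(** Trades the Radon-Nikodym derivative in [KL] for a finite nonnegative version. The set where [q]
    vanishes has [Q]-mass equal to the integral of [q] over it, which is 0; hence [lne] and [ln]
    agree [Q]-almost everywhere. *)
Lemma real_density (Q : probability T R) : Q `<< P ->
  exists q : T -> R, [/\ measurable_fun setT q, forall x, (0 <= q x)%R,
    Q [set x | (0 < q x)%R] = 1,
    forall f B, (forall x, 0 <= f x) -> measurable B -> measurable_fun B f ->
      \int[P]_(x in B) (f x * (q x)%:E) = \int[Q]_(x in B) f x &
    KL Q P = \int[Q]_x (ln (q x))%:E].
Proof.
move=> QP.
pose g := Radon_Nikodym_SigmaFinite.f Q P.
have gfin x : g x \is a fin_num by exact: Radon_Nikodym_SigmaFinite.f_fin_num.
have mg : measurable_fun setT g.
  exact: measurable_int (Radon_Nikodym_SigmaFinite.f_integrable QP).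
pose q := fine \o g.
have qE x : (q x)%:E = g x by rewrite /q/= fineK.
have mq : measurable_fun setT q by exact: measurableT_comp.
have q0 x : (0 <= q x)%R.
  by rewrite -lee_fin qE; exact: Radon_Nikodym_SigmaFinite.f_ge0.
have mpos : measurable [set x | (0 < q x)%R].
  rewrite (_ : [set x | _] = q @^-1` `]0%R, +oo[)//; last first.
    by apply/seteqP; split => x /=; rewrite in_itv/= andbT.
  by rewrite -[X in measurable X]setTI; exact: mq.
have qpos : Q [set x | (0 < q x)%R] = 1.
  have := probability_setC Q (measurableC mpos); rewrite setCK => ->.
  rewrite [X in _ - X](_ : _ = 0) ?sube0//.
  rewrite (Radon_Nikodym_SigmaFinite.f_integral QP); last exact: measurableC.
  apply: integral0_eq => x /= /negP; rewrite -leNgt => qx.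
  by rewrite -/(g x) -qE (le_anti (introT andP (conj qx (q0 x)))).
exists q; split => //.
  move=> f B f0 mB mf; rewrite -(Radon_Nikodym_SigmaFinite.change_of_variables QP)//.
  by apply: eq_integral => x _; rewrite qE.
rewrite /KL; apply: ae_eq_integral => //.
- apply: (measurableT_comp measurable_lne); apply: measurable_int.
  exact: Radon_Nikodym_integrable.
- exact/measurable_EFinP/measurableT_comp.
have /(null_dominates_ae QP) ae1 :=
  ae_eq_Radon_Nikodym_SigmaFinite QP measurableT.
have ae2 : {ae Q, forall x, (0 < q x)%R}.
  exists (~` [set x | (0 < q x)%R]); split => //; first exact: measurableC.
  exact: prob1_negligible.
apply: filterS2 ae1 ae2 => x /(_ I) gx qx _.
by rewrite -gx -/(g x) -qE lne_EFin.
Qed.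

End density.

(** * Gibbs' inequality and its equality case *)

Section gibbs.
Context {d : measure_display} {T : measurableType d} {R : realType}.
Variables (P : probability T R).
Implicit Types (Q : probability T R) (A B : set T) (h : T -> R).

Let mexp h D : measurable_fun setT h ->
  measurable_fun D (fun x => (expR (h x))%:E).
Proof. by move=> mh; apply: measfun_EFin; exact: measurableT_comp. Qed.

Lemma has_density_null Q A h : measurable A -> measurable_fun setT h ->
  has_density P Q A h -> Q `<< P.
Proof.
move=> mA mh QA; apply/null_content_dominatesP => B mB PB0.
rewrite QA//; apply: null_set_integral; [exact: measurableI|exact: mexp|].
by apply/eqP; rewrite -measure_le0 -PB0 le_measure ?inE//; exact: measurableI.
Qed.

Lemma has_density_mass Q A h : measurable A -> has_density P Q A h -> Q A = 1.
Proof.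
move=> mA QA; rewrite -(@probability_setT _ _ _ Q).
by rewrite QA// [RHS]QA// setIid setTI.
Qed.

(** Densities are unique up to [P]-null sets, so [q = exp h] almost everywhere on [A], which carries
    [Q]. *)
Lemma KL_has_density Q A h : measurable A -> measurable_fun setT h ->
  has_density P Q A h -> KL Q P = \int[Q]_x (h x)%:E /\
  forall f B, (forall x, 0 <= f x) -> measurable B -> measurable_fun setT f ->
    \int[Q]_(x in B) f x = \int[P]_(x in B `&` A) (f x * (expR (h x))%:E).
Proof.
move=> mA mh QA; have QP := has_density_null mA mh QA.
have QA1 := has_density_mass mA QA.
have [q [mq q0 qpos qf ->]] := real_density QP.
have qQ B : measurable B -> \int[P]_(x in B) (q x)%:E = Q B.
  move=> mB; rewrite -[RHS]mul1e -integral_cst// -qf//.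
  by apply: eq_integral => x _; rewrite mul1e.
have qh : ae_eq P A (fun x => (q x)%:E) (fun x => (expR (h x))%:E).
  apply: integral_ae_eq => //.
  - apply/integrableP; split; first exact: measfun_EFin.
    under eq_integral do rewrite gee0_abs ?lee_fin//.
    by rewrite qQ// (le_lt_trans (probability_le1 _ _))// ltry.
  - exact: mexp.
  - by move=> B BA mB; rewrite qQ// QA// (setIidl BA).
split.
  rewrite (prob1_integral mA _ QA1); last exact/measfun_EFin/measurableT_comp.
  rewrite [RHS](prob1_integral mA _ QA1); last exact: measfun_EFin.
  apply: ae_eq_integral => //; [exact/measfun_EFin/measurableT_comp|exact: measfun_EFin|].
  apply: filterS (null_dominates_ae QP qh) => x /[swap] Ax /(_ Ax)[->].
  by rewrite expRK.
move=> f B f0 mB mf.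
transitivity (\int[Q]_(x in B `&` A) f x).
  rewrite integral_mkcondr; apply: ae_eq_integral => //.
  - exact: measurable_funTS.
  - exact/measurable_funTS/(measurable_restrictT _ mA)/measurable_funTS.
  - exists (~` A); split; [exact: measurableC|exact: prob1_negligible|].
    by move=> x /= + Ax; apply => _; rewrite patchE mem_set.
have mBA : measurable (B `&` A) by exact: measurableI.
rewrite -qf//; last exact: measurable_funTS.
apply: ae_eq_integral => //.
- by apply: emeasurable_funM; [exact: measurable_funTS|exact: measfun_EFin].
- by apply: emeasurable_funM; [exact: measurable_funTS|exact: mexp].
- by apply: filterS qh => x + [Bx Ax] => /(_ Ax) ->.
Qed.

Lemma integral_has_density Q A h (f : T -> R) : measurable A ->
  measurable_fun setT h -> measurable_fun setT f -> has_density P Q A h ->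
  \int[Q]_x (f x)%:E = \int[P]_(x in A) (f x * expR (h x))%:E.
Proof.
move=> mA mh mf QA; have [_ Qf] := KL_has_density mA mh QA.
rewrite integralE [RHS]integralE; congr (_ - _).
  rewrite Qf//; last by apply: measurable_funepos; exact: measfun_EFin.
  rewrite setTI; apply: eq_integral => x _.
  by rewrite !funeposE EFinM maxe_pMl ?lee_fin ?expR_ge0// mul0e.
rewrite Qf//; last by apply: measurable_funeneg; exact: measfun_EFin.
rewrite setTI; apply: eq_integral => x _.
by rewrite !funenegE EFinM -mulNe maxe_pMl ?lee_fin ?expR_ge0// mul0e.
Qed.

Lemma gibbs Q A h : measurable A -> measurable_fun setT h ->
  Q `<< P -> Q A = 1 -> \int[P]_(x in A) (expR (h x))%:E <= 1 -> KL Q P < +oo ->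
  [/\ \int[Q]_(x in A) (fun x => (h x)%:E)^\+ x < +oo,
      \int[Q]_(x in A) (h x)%:E <= KL Q P &
      \int[Q]_(x in A) (h x)%:E = KL Q P -> has_density P Q A h].
Proof.
move=> mA mh QP QA1 hA1.
have [q [mq q0 qpos qf ->]] := real_density QP.
pose C := [set x | (0 < q x)%R].
have mC : measurable C.
  rewrite (_ : C = q @^-1` `]0%R, +oo[)//; last first.
    by apply/seteqP; split => x /=; rewrite in_itv/= andbT.
  by rewrite -[X in measurable X]setTI; exact: mq.
pose D := A `&` C.
have mD : measurable D by exact: measurableI.
have QD : Q D = 1 by rewrite prob1I.
have DE (f : T -> R) : measurable_fun setT f ->
    \int[Q]_(x in A) (f x)%:E = \int[Q]_(x in D) (f x)%:E.
  move=> mf; rewrite -(prob1_integral mA)//; last exact: measfun_EFin.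
  by rewrite (prob1_integral mD)//; exact: measfun_EFin.
pose l x := ln (q x).
have ml : measurable_fun setT l by exact: measurableT_comp.
rewrite -/l (prob1_integral mD)//; last exact: measfun_EFin.
rewrite DE//.
pose u x := (expR (h x) / q x)%R.
pose iq x := ((q x)^-1)%R.
have miq : measurable_fun setT iq.
  rewrite (_ : iq = fun x => q x `^ (-1))%R; last first.
    by apply/funext => x; rewrite /iq powR_inv1.
  exact: measurableT_comp (measurable_powR _) mq.
have mu : measurable_fun setT u.
  by apply: measurable_funM miq; exact: measurableT_comp.
have u0 x : (0 <= u x)%R by rewrite divr_ge0 ?expR_ge0.
have uE B : measurable B ->
    \int[Q]_(x in B `&` D) (u x)%:E = \int[P]_(x in B `&` D) (expR (h x))%:E.
  move=> mB; rewrite -qf//; last 2 first.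
  - exact: measurableI.
  - exact: measfun_EFin.
  apply: eq_integral => x; rewrite inE => -[Bx [Ax Cx]].
  by rewrite -EFinM divfK// gt_eqF.
have uD1 : \int[Q]_(x in D) (u x)%:E <= 1.
  rewrite -[D]setTI uE// setTI (le_trans _ hA1)//.
  by apply: ge0_subset_integral => //; [exact: mexp|exact: subIsetl].
move=> KLoo.
have il : Q.-integrable D (fun x => (l x)%:E).
  apply: integrable_neg_lty => //; first exact: measfun_EFin.
  (* Where [q > 0], the negative part of [ln q] is at most [1 / q], and the integral of [1 / q]
     against [Q] over [D] is [P D]. *)
  apply: (@le_lt_trans _ _ (\int[Q]_(x in D) (iq x)%:E)).
    apply: ge0_le_integral => //; [|exact: measfun_EFin|].
      by apply: measurable_funeneg; exact: measfun_EFin.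
    move=> x [_ Cx]; rewrite funenegE ge_max -EFinN !lee_fin /iq invr_ge0 q0 andbT.
    by rewrite /l -lnV ?posrE// ltW// ln_sublinear// invr_gt0.
  rewrite -qf//; [|by move=> x; rewrite lee_fin /iq invr_ge0|exact: measfun_EFin].
  rewrite (eq_integral (cst 1)); last first.
    by move=> x; rewrite inE => -[_ Cx]; rewrite -EFinM mulVf// gt_eqF.
  by rewrite integral_cst// mul1e (le_lt_trans (probability_le1 _ _))// ltry.
have iu : Q.-integrable D (fun x => (u x)%:E).
  apply/integrableP; split; first exact: measfun_EFin.
  under eq_integral do rewrite gee0_abs ?lee_fin//.
  by rewrite (le_lt_trans uD1)// ltry.
have i1 : Q.-integrable D (cst 1).
  exact: finite_measure_integrable_cst.
pose phi x := (l x + (u x - 1))%R.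
have mphi : measurable_fun setT phi.
  by apply: measurable_funD => //; exact: measurable_funB.
have iu1 : Q.-integrable D (fun x => (u x - 1)%:E).
  rewrite (_ : (fun x => _) = (fun x => (u x)%:E) \- cst 1)//.
  exact: integrableB.
have iphi : Q.-integrable D (fun x => (phi x)%:E).
  rewrite (_ : (fun x => _) = (fun x => (l x)%:E) \+ (fun x => (u x - 1)%:E))//.
  exact: integrableD.
have phiE : \int[Q]_(x in D) (phi x)%:E =
    \int[Q]_(x in D) (l x)%:E + (\int[Q]_(x in D) (u x)%:E - 1).
  under eq_integral do rewrite EFinD.
  rewrite integralD//; congr (_ + _); under eq_integral do rewrite EFinB.
  rewrite integralB//; congr (_ - _).
  by rewrite integral_cst// mul1e; exact: QD.
have phiKL : \int[Q]_(x in D) (phi x)%:E <= \int[Q]_(x in D) (l x)%:E.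
  by rewrite phiE -[leRHS]adde0 leeD2l// sube_le0.
have lu x : C x -> (h x - l x = ln (u x))%R.
  by move=> Cx; rewrite /u ln_div ?posrE ?expR_gt0// expRK.
have hphi x : C x -> (h x <= phi x)%R.
  move=> Cx; rewrite /phi addrC -lerBlDr lu//.
  have {1}-> : u x = (1 + (u x - 1))%R by rewrite addrC subrK.
  by rewrite le_ln1Dx// ltrBrDl subrr divr_gt0 ?expR_gt0.
split.
- rewrite (_ : \int[Q]_(x in A) _ = \int[Q]_(x in D) (fun x => (h x)%:E)^\+ x); last first.
    rewrite -(prob1_integral mA)//; last by apply: measurable_funepos; exact: measfun_EFin.
    by rewrite (prob1_integral mD)//; apply: measurable_funepos; exact: measfun_EFin.
  apply: (@le_lt_trans _ _ (\int[Q]_(x in D) (fun x => (phi x)%:E)^\+ x)); last first.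
    exact: integral_funepos_lt_pinfty.
  apply: ge0_le_integral => //.
  + by apply: measurable_funepos; exact: measfun_EFin.
  + by apply: measurable_funepos; exact: measfun_EFin.
  + by move=> x [_ Cx]; rewrite !funeposE ge_max !le_max lee_fin hphi//= lexx orbT.
- apply: le_trans phiKL; apply: le_integral_ext => //; [exact: measfun_EFin..|].
  by move=> x [_ Cx]; rewrite lee_fin hphi.
- move=> hKL.
  have KLfin : \int[Q]_(x in D) (l x)%:E \is a fin_num.
    exact: integrable_fin_num.
  have ih : Q.-integrable D (fun x => (h x)%:E).
    by apply: integrable_fin_integral => //; [exact: measfun_EFin|rewrite hKL].
  pose psi x := (phi x - h x)%R.
  have mpsi : measurable_fun setT psi by exact: measurable_funB.
  have psi0 x : D x -> (0 <= psi x)%R by move=> [_ Cx]; rewrite subr_ge0 hphi.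
  have psiE : \int[Q]_(x in D) (psi x)%:E = \int[Q]_(x in D) (u x)%:E - 1.
    under eq_integral do rewrite EFinB.
    by rewrite integralB// hKL phiE addeAC subee// add0e.
  have psi_ge0 : 0 <= \int[Q]_(x in D) (psi x)%:E.
    by apply: integral_ge0 => x Dx; rewrite lee_fin psi0.
  have uD : \int[Q]_(x in D) (u x)%:E = 1.
    apply/eqP; rewrite eq_le uD1/=.
    by rewrite -sube_ge0 ?fin_numE// -psiE.
  have : \int[Q]_(x in D) `|(psi x)%:E| = 0.
    rewrite (eq_integral (fun x => (psi x)%:E)); last first.
      by move=> x; rewrite inE => Dx; rewrite gee0_abs// lee_fin psi0.
    by rewrite psiE uD subee.
  move=> /(ae_eq_integral_abs Q mD (measfun_EFin mpsi)) psi_eq0.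
  have u1 : ae_eq Q D (fun x => (u x)%:E) (cst 1).
    apply: filterS psi_eq0 => x + Dx => /(_ Dx)[].
    have [_ Cx] := Dx.
    have upos : (0 < u x)%R by rewrite divr_gt0 ?expR_gt0.
    rewrite /psi /phi addrAC -opprB -[X in (- X + _)%R]opprB opprK.
    move=> psi0x.
    have lnu : ln (u x) = (u x - 1)%R by rewrite -lu//; lra.
    (* [ln u = u - 1] leaves only [u = 1], since [exp t > 1 + t] for [t] nonzero. *)
    have [//|] := eqVneq (ln (u x)) 0%R.
      by move/eqP; rewrite ln_eq0// => /eqP ->.
    move=> /expR_gt1Dx; rewrite lnK ?posrE// lnu.
    by rewrite addrC subrK ltxx.
  move=> B mB.
  have mBD : measurable (B `&` D) by exact: measurableI.
  have BD : \int[P]_(x in B `&` D) (expR (h x))%:E = Q B.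
    rewrite -uE// -(prob1I mD mB QD) -[RHS]mul1e -integral_cst//.
    apply: ae_eq_integral => //; first exact: measfun_EFin.
    by apply: filterS u1 => x + [_ Dx]; exact.
  (* [exp h] has mass at most 1 on [A] and already has mass 1 on [D]. *)
  have AD0 : \int[P]_(x in A `\` D) (expR (h x))%:E = 0.
    have : \int[P]_(x in A) (expR (h x))%:E =
        1 + \int[P]_(x in A `\` D) (expR (h x))%:E.
      rewrite -uD -[D in X in X + _]setTI uE// setTI.
      rewrite -ge0_integral_setU//.
      - by rewrite setDUK//; exact: subIsetl.
      - exact: measurableD.
      - exact: mexp.
      - by rewrite disj_set2E setDIK.
    move=> AE; apply/eqP; rewrite eq_le integral_ge0 ?andbT//.
    by move: hA1; rewrite AE -[leRHS]adde0 leeD2lE.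
  rewrite -BD; apply/eqP; rewrite eq_le; apply/andP; split.
    apply: ge0_subset_integral => //; [exact: measurableI|exact: mexp|].
    by move=> x [Bx [Ax _]].
  rewrite -[leRHS]adde0 -AD0 -ge0_integral_setU//; last 3 first.
  + exact: measurableD.
  + exact: mexp.
  + by rewrite disj_set2E; apply/eqP/seteqP; split => x // [[_ Dx]] [_ /(_ Dx)].
  apply: ge0_subset_integral => //; [exact: measurableI| |exact: mexp|].
  + by apply: measurableU => //; exact: measurableD.
  + move=> x [Bx Ax]; have [Dx|nDx] := pselect (D x); [by left|by right].
Qed.

End gibbs.

(** Supplies indices that are large and at which [t] is near [s]: a large index is what makes the
    corresponding strip contain a given one. *)
Lemma cluster_segment {R : realType} (a b : R) (t : nat -> R) :
  (forall k, a <= t k <= b)%R ->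
  exists2 s, (a <= s <= b)%R &
    forall (U : set R) (M : nat), nbhs s U -> exists2 k, (M <= k)%N & U (t k).
Proof.
move=> tab.
have := @segment_compact R a b (t @ \oo) _ _; case.
  by exists 0%N => // k _ /=; rewrite in_itv/=.
move=> s [/=]; rewrite in_itv/= => sab cls; exists s => // U M sU.
have [|_ [[k /= Mk <-] Uk]] := cls (t @` [set k | (M <= k)%N]) U _ sU.
  by exists M => // k Mk /=; exists k.
by exists k.
Qed.

(** * Laplace transforms on strips and the limit of the truncated problems *)

Section laplace.
Context {d : measure_display} {T : measurableType d} {R : realType}.
Variables (P : probability T R) (Y : T -> R).
Hypothesis mY : measurable_fun setT Y.

Let mexpY (s : R) : measurable_fun setT (fun x => expR (- s * Y x)).
Proof. by apply: measurableT_comp => //; exact: measurable_funM. Qed.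

Lemma expR_integral_gt0 (A : set T) (h : T -> R) : measurable A ->
  measurable_fun setT h -> 0 < P A -> 0 < \int[P]_(x in A) (expR (h x))%:E.
Proof.
move=> mA mh PA; rewrite lt_neqAle integral_ge0// andbT; apply/eqP => I0.
have : ae_eq P A (fun x => (expR (h x))%:E) (cst 0).
  apply/ae_eq_integral_abs => //; first by apply: measfun_EFin; exact: measurableT_comp.
  rewrite [LHS](_ : _ = \int[P]_(x in A) (expR (h x))%:E)//.
  by apply: eq_integral => x _; rewrite gee0_abs.
move=> [C [mC C0 sC]]; move: PA; rewrite ltNge -C0 => /negP; apply.
apply: le_measure; rewrite ?inE//; apply: subset_trans sC => x Ax /= /(_ Ax)[] /eqP.
by rewrite gt_eqF ?expR_gt0.
Qed.

Lemma expR_bound (M s a x : R) : (`|x| <= M)%R -> (`|s| <= a)%R ->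
  (expR (- s * x) <= expR (a * M))%R.
Proof.
move=> xM sa; rewrite ler_expR; apply: le_trans (ler_norm _) _.
by rewrite normrM normrN ler_pM.
Qed.

Lemma bounded_laplace_integrable (A : set T) (w : T -> R) (M W s : R) : measurable A ->
  measurable_fun setT w ->
  (forall x, A x -> `|Y x| <= M)%R -> (forall x, A x -> `|w x| <= W)%R ->
  P.-integrable A (EFin \o (fun x => w x * expR (- s * Y x)))%R.
Proof.
move=> mA mw YM wW; apply: measurable_bounded_integrable => //.
- by rewrite (le_lt_trans (probability_le1 _ _))// ltry.
- by apply: measurable_funTS; exact: measurable_funM.
- exists (W * expR (`|s| * M))%R; split; first exact: num_real.
  move=> z Wz x Ax; apply: le_trans (ltW Wz).
  rewrite normrM ler_pM ?wW// ger0_norm ?expR_ge0//.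
  exact: (expR_bound (YM _ Ax)).
Qed.

(** Dominated convergence on []s - 1, s + 1[], with the constant bound [W exp((|s| + 1) M)]. The
    weight is [Y] for the intermediate value theorem and 1 for the passage to the cluster point. *)
Lemma continuous_bounded_laplace (A : set T) (w : T -> R) (M W : R) : measurable A ->
  measurable_fun setT w ->
  (forall x, A x -> `|Y x| <= M)%R -> (forall x, A x -> `|w x| <= W)%R ->
  continuous (fun s : R => \int[P]_(x in A) (w x * expR (- s * Y x)))%R.
Proof.
move=> mA mw YM wW s.
have ss : (s : R) \in (`](s - 1)%R, (s + 1)%R[%classic : set R).
  by rewrite inE/= in_itv/= ltrBlDr !ltrDl ltr01.
have int_f (r : R) : `](s - 1)%R, (s + 1)%R[%classic r ->
    P.-integrable A (EFin \o (fun x => w x * expR (- r * Y x))%R).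
  by move=> _; exact: bounded_laplace_integrable YM wW.
have cw x : continuous (fun r : R => w x * expR (- r * Y x))%R.
  move=> r; apply: cvgM; first exact: cvg_cst.
  apply: continuous_cvg; first exact: continuous_expR.
  by apply: cvgM; [apply: cvgN; exact: cvg_id|exact: cvg_cst].
have cf : {ae P, forall x, A x -> {in `](s - 1)%R, (s + 1)%R[%classic,
    continuous (fun r : R => w x * expR (- r * Y x))%R}}.
  by apply: aeW => x Ax r _; exact: cw.
have int_g : P.-integrable A (EFin \o (fun=> W * expR ((`|s| + 1) * M))%R).
  exact: finite_measure_integrable_cst.
apply: (continuity_under_integral mA int_f cf int_g _ ss).
move=> r; rewrite /= in_itv/= => /andP[sr rs]; apply: aeW => x Ax.
rewrite normrM ler_pM ?wW// ger0_norm ?expR_ge0//.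
apply: (expR_bound (YM _ Ax)).
rewrite -[r](subrK s) addrC (le_trans (ler_normD _ _))// lerD2l.
by rewrite ler_norml; lra.
Qed.

Definition strip (n : nat) : set T := [set x | (`|Y x| <= n%:R)%R].

Lemma measurable_strip n : measurable (strip n).
Proof.
rewrite (_ : strip n = Y @^-1` `[(- n%:R)%R, n%:R%R]%classic)//; last first.
  by apply/seteqP; split => x; rewrite /strip/= in_itv/= ler_norml.
rewrite -[X in measurable X]setTI; exact: mY.
Qed.

Lemma strip_nd : nondecreasing_seq strip.
Proof.
move=> m n mn; apply/subsetPset => x; rewrite /strip/= => /le_trans; apply.
by rewrite ler_nat.
Qed.

Lemma strip_cover : \bigcup_n strip n = setT.
Proof.
apply/seteqP; split => // x _; exists (Num.truncn `|Y x|).+1 => //.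
by rewrite /strip/= ltW// truncnS_gt.
Qed.

(** By monotone convergence the positive part over some strip exceeds the full integral of the
    negative part; larger strips only increase the former, and the negative part over a strip never
    exceeds the full one. This also covers a mean equal to [+oo]. *)
Lemma strip_positive_mean : \int[P]_x (fun x => (Y x)%:E)^\- x < +oo ->
  0 < \int[P]_x (Y x)%:E ->
  exists N, forall n, (N <= n)%N -> (0 <= \int[P]_(x in strip n) Y x)%R.
Proof.
move=> Yn; rewrite integralE => Ypos.
have {}Ypos : \int[P]_x (fun x => (Y x)%:E)^\- x < \int[P]_x (fun x => (Y x)%:E)^\+ x.
  by rewrite -sube_gt0.
have mYp : measurable_fun setT (fun x => (Y x)%:E)^\+.
  by apply: measurable_funepos; exact: measfun_EFin.
have cvgp := @ge0_nondecreasing_set_cvg_integral _ _ _ strip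
  (fun x => (Y x)%:E)^\+ P strip_nd measurable_strip
  (fun i => measurable_funTS mYp) (fun i x _ => funepos_ge0 _ x).
have ndp := @ge0_nondecreasing_set_nondecreasing_integral _ _ _ strip
  (fun x => (Y x)%:E)^\+ P strip_nd measurable_strip
  (fun i => measurable_funTS mYp) (fun i x _ => funepos_ge0 _ x).
rewrite strip_cover in cvgp.
have [N hN] : exists N, \int[P]_x (fun x => (Y x)%:E)^\- x <
    \int[P]_(x in strip N) (fun x => (Y x)%:E)^\+ x.
  apply: contrapT => /forallNP h; move: Ypos; rewrite ltNge => /negP; apply.
  rewrite -(cvg_lim _ cvgp)//; apply: lime_le.
    by apply/cvg_ex; eexists; exact: cvgp.
  by apply: nearW => n; rewrite leNgt; apply/negP/h.
exists N => n Nn; apply: fine_ge0.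
rewrite integralE sube_ge0; last first.
  have : P.-integrable (strip n) (fun x => (Y x)%:E).
    apply: measurable_bounded_integrable => //.
    - exact: measurable_strip.
    - rewrite (le_lt_trans (probability_le1 _ _)) ?ltry//; exact: measurable_strip.
    - exact: measurable_funTS.
    - by exists n%:R; split => // z nz x /le_trans; apply; exact: ltW.
  move=> iY; apply/orP; right.
  by apply: integrable_pos_fin_num => //; exact: measurable_strip.
apply: le_trans (ndp _ _ Nn); apply/ltW; apply: le_lt_trans hN.
apply: ge0_subset_integral => //; first exact: measurable_strip.
by apply: measurable_funeneg; exact: measfun_EFin.
Qed.

Lemma negative_part_charged : P [set x | (Y x < 0)%R] != 0 ->
  exists N (e : R), (0 < e)%R /\
    0 < P (strip N `&` [set x | (Y x <= - e)%R]).
Proof.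
move=> Yneg; pose B k := strip k `&` [set x | (Y x <= - k.+1%:R^-1)%R].
have mB k : measurable (B k).
  apply: measurableI; first exact: measurable_strip.
  rewrite -[X in measurable X]setTI.
  rewrite (_ : [set x | _] = Y @^-1` `]-oo, (- k.+1%:R^-1)%R]%classic)//.
  exact: mY.
have [k Bk] : exists k, 0 < P (B k).
  apply: contrapT => /forallNP B0; move: Yneg => /negP; apply; apply/eqP.
  have : P.-negligible (\bigcup_k B k).
    apply: negligible_bigcup => k; apply/negligibleP => //.
    apply/eqP; rewrite -measure_le0 leNgt; apply/negP; exact: B0.
  move=> [C [mC C0 sC]]; apply/eqP; rewrite -measure_le0 -C0.
  apply: le_measure; rewrite ?inE//.
    rewrite (_ : [set x | _] = Y @^-1` `]-oo, 0%R[%classic)//.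
    by rewrite -[X in measurable X]setTI; exact: mY.
  apply: subset_trans sC => x /= Yx.
  (* The first entry puts [x] in the strip, the second makes [1 / (m + 1) <= - Y x]. *)
  pose m := maxn (Num.truncn `|Y x|).+1 (Num.truncn (- Y x)^-1).
  exists m => //; split; rewrite /strip/=.
    rewrite (@le_trans _ _ (Num.truncn `|Y x|).+1%:R)//.
      by rewrite ltW// truncnS_gt.
    by rewrite ler_nat leq_maxl.
  rewrite lerNr invf_ple ?posrE ?oppr_gt0//.
  rewrite (@le_trans _ _ (Num.truncn (- Y x)^-1).+1%:R)//.
    by rewrite ltW// truncnS_gt.
  by rewrite ler_nat ltnS leq_maxr.
by exists k, k.+1%:R^-1%R; split.
Qed.

(** [K] must not depend on [n]. With [B] the part of a fixed strip where [Y <= - e], one has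
    [Y exp(- K Y) <= - e] on [B] and [Y exp(- K Y) <= 1 / K] everywhere, because [z <= exp z]. The
    negative contribution of [B] thus outweighs the rest once [1 / K] is at most [e P(B)], on every
    strip containing [B]. *)
Lemma laplace_vanishing_mean : P [set x | (Y x < 0)%R] != 0 ->
  \int[P]_x (fun x => (Y x)%:E)^\- x < +oo -> 0 < \int[P]_x (Y x)%:E ->
  exists N (K : R), forall n, (N <= n)%N -> 0 < P (strip n) /\
    exists2 s : R, (0 <= s <= K)%R &
      (\int[P]_(x in strip n) (Y x * expR (- s * Y x)) = 0)%R.
Proof.
move=> /negative_part_charged[N1 [e [e0 PB]]] Yn Yp.
have [N2 mean_ge0] := strip_positive_mean Yn Yp.
set B := _ `&` _ in PB.
have mB : measurable B.
  apply: measurableI; first exact: measurable_strip.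
  rewrite -[X in measurable X]setTI.
  rewrite (_ : [set x | _] = Y @^-1` `]-oo, (- e)%R]%classic)//.
  exact: mY.
pose p := fine (P B).
have pE : P B = p%:E by rewrite fineK// fin_num_measure.
have p0 : (0 < p)%R by rewrite -lte_fin -pE.
(* Chosen so that [1 / K = e p]: the integrand at [K] is then at most [e p - e 1_B], whose integral
   over a strip is at most 0. *)
pose K := ((e * p)^-1)%R.
have K0 : (0 < K)%R by rewrite invr_gt0 mulr_gt0.
exists (maxn N1 N2), K => n; rewrite geq_max => /andP[N1n N2n].
have mSn := measurable_strip n.
have BSn : B `<=` strip n.
  by move=> x [xN1 _]; have /subsetPset := strip_nd N1n; apply.
split.
  by apply: lt_le_trans PB _; rewrite le_measure ?inE.
pose G (s : R) := (\int[P]_(x in strip n) (Y x * expR (- s * Y x)))%R.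
have cG : continuous G by exact: (continuous_bounded_laplace (M := n%:R) (W := n%:R)).
have iG s : P.-integrable (strip n) (EFin \o (fun x => Y x * expR (- s * Y x))%R).
  exact: (bounded_laplace_integrable (M := n%:R) (W := n%:R)).
have G0 : (0 <= G 0)%R.
  have := mean_ge0 _ N2n; congr (0 <= _)%R; apply: eq_Rintegral => x _.
  by rewrite oppr0 mul0r expR0 mulr1.
have GK : (G K <= 0)%R.
  have i1 : P.-integrable (strip n) (EFin \o (fun=> e * p)%R).
    exact: finite_measure_integrable_cst.
  have i2 : P.-integrable (strip n) (EFin \o (fun x => e * \1_B x))%R.
    rewrite (_ : EFin \o _ = (fun x => e%:E * (\1_B x)%:E))//.
    apply: (integrableZl mSn); apply: (integrableS measurableT) => //.
    exact: integrable_indic.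
  apply: (@le_trans _ _ (\int[P]_(x in strip n) (e * p - e * \1_B x))%R).
    apply: le_Rintegral => //.
      rewrite (_ : EFin \o _ = (EFin \o (fun=> (e * p)%R)) \-
        (EFin \o (fun x => (e * \1_B x)%R)))//.
      exact: integrableB.
    move=> x _; rewrite indicE; have [xB|xB] := boolP (x \in B).
      move: xB; rewrite inE => -[_ /= Yx].
      rewrite mulr1; apply: (@le_trans _ _ (- e)%R); last first.
        by rewrite lerBrDl subrr mulr_ge0// ltW.
      have E1 : (1 <= expR (- K * Y x))%R.
        rewrite -expR0 ler_expR mulNr -mulrN mulr_ge0 ?ltW// oppr_gt0.
        by rewrite (le_lt_trans Yx)// oppr_lt0.
      by nra.
    rewrite mulr0 subr0; have [Yx|Yx] := leP (Y x) 0%R.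
      rewrite (@le_trans _ _ 0%R)//; last by rewrite mulr_ge0// ltW.
      by rewrite mulr_le0_ge0// expR_ge0.
    rewrite -[leRHS]invrK -/K -(ler_pM2l K0) mulfV ?gt_eqF// mulrA.
    rewrite mulNr expRN ler_pdivrMr ?expR_gt0// mul1r.
    by apply: le_trans (expR_ge1Dx _); rewrite lerDr.
  rewrite RintegralB// Rintegral_cst// RintegralZl//; last first.
    by apply: (integrableS measurableT) => //; exact: integrable_indic.
  rewrite /Rintegral integral_indic// (setIidl BSn) -/p subr_le0 -mulrA.
  apply: ler_wpM2l; first exact: ltW.
  apply: ler_piMr; first exact: ltW.
  by rewrite -lee_fin fineK ?fin_num_measure// probability_le1.
have [||s] := @IVT _ G 0%R K 0%R (ltW K0).
- exact: continuous_subspaceT.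
- by rewrite ge_min le_max G0 GK orbT.
- by rewrite in_itv/= => sK Gs; exists s.
Qed.

(** The law with density [exp(- s Y) / f] on the strip has mean 0, so its entropy [- s * 0 - ln f]
    reduces to [- ln f]. [D] stands for the primal infimum and is tested only against laws of mean
    exactly 0. *)
Lemma strip_tilt (D : \bar R) (n : nat) (s : R) :
  (forall Q : probability T R, Q `<< P -> Q.-integrable setT (EFin \o Y) ->
    \int[Q]_x (Y x)%:E = 0 -> D <= KL Q P) ->
  0 < P (strip n) ->
  (\int[P]_(x in strip n) (Y x * expR (- s * Y x)) = 0)%R ->
  exists f : R, [/\ (0 < f)%R,
    \int[P]_(x in strip n) (expR (- s * Y x))%:E = f%:E & D <= (- ln f)%:E].
Proof.
move=> DKL Pn Gs; have mSn := measurable_strip n.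
have iF : P.-integrable (strip n) (EFin \o (fun x => expR (- s * Y x))%R).
  have := @bounded_laplace_integrable (strip n) (cst 1%R) n%:R 1%R s mSn.
  move=> /(_ (measurable_cst _) (fun=> id)).
  under eq_fun do rewrite mul1r.
  by apply => x _; rewrite normr1.
pose f := fine (\int[P]_(x in strip n) (expR (- s * Y x))%:E).
have fE : \int[P]_(x in strip n) (expR (- s * Y x))%:E = f%:E.
  by rewrite fineK//; exact: integrable_fin_num.
have f0 : (0 < f)%R.
  rewrite -lte_fin -fE; apply: expR_integral_gt0 => //.
  exact: measurable_funM.
exists f; split => //.
pose h x := (- s * Y x - ln f)%R.
have mh : measurable_fun setT h.
  by apply: measurable_funB => //; exact: measurable_funM.
have hE x : expR (h x) = (expR (- s * Y x) / f)%R.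
  by rewrite expRB lnK.
have h1 : \int[P]_(x in strip n) (expR (h x))%:E = 1.
  under eq_integral do rewrite hE EFinM.
  rewrite ge0_integralZr//; last 2 first.
  - exact: measfun_EFin.
  - by rewrite lee_fin invr_ge0 ltW.
  by rewrite fE -EFinM divff ?gt_eqF.
have [Q Qh] := has_density_exists mSn mh h1.
have QS := has_density_mass mSn Qh.
have QY0 : \int[Q]_x (Y x)%:E = 0.
  rewrite (integral_has_density mSn mh mY Qh).
  under eq_integral do rewrite hE mulrA EFinM.
  rewrite integralZr//; last first.
    exact: (bounded_laplace_integrable (M := n%:R) (W := n%:R)).
  rewrite -[X in X * _]fineK; first by rewrite [X in X%:E * _]Gs mul0e.
  apply: integrable_fin_num => //.
  exact: (bounded_laplace_integrable (M := n%:R) (W := n%:R)).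
have iY : Q.-integrable setT (EFin \o Y).
  apply: integrable_fin_integral => //; first exact: measfun_EFin.
  by rewrite QY0.
have -> : (- ln f)%:E = KL Q P.
  have [-> _] := KL_has_density mSn mh Qh.
  rewrite (_ : (fun x => (h x)%:E) =
      (fun x => (- s)%:E * (Y x)%:E - (ln f)%:E)); last exact/funext.
  rewrite integralB//; last 2 first.
  - exact: (integrableZl measurableT).
  - exact: finite_measure_integrable_cst.
  rewrite integralZl// QY0 mule0 sub0e.
  by rewrite prob_integral_cst EFinN.
by apply: DKL => //; exact: has_density_null Qh.
Qed.

Lemma dual_attained (D : \bar R) : 0 <= D ->
  (forall Q : probability T R, Q `<< P -> Q.-integrable setT (EFin \o Y) ->
    \int[Q]_x (Y x)%:E = 0 -> D <= KL Q P) ->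
  P [set x | (Y x < 0)%R] != 0 ->
  \int[P]_x (fun x => (Y x)%:E)^\- x < +oo -> 0 < \int[P]_x (Y x)%:E ->
  exists s l : R, [/\ (0 <= s)%R, \int[P]_x (expR (- s * Y x))%:E = (expR l)%:E &
    D <= (- l)%:E].
Proof.
move=> D0 DKL Yneg Yn Yp.
have [N [K NK]] := laplace_vanishing_mean Yneg Yn Yp.
have tilt n : exists s : R, (0 <= s <= K)%R /\ exists f : R, [/\ (0 < f)%R,
    \int[P]_(x in strip (N + n)) (expR (- s * Y x))%:E = f%:E & D <= (- ln f)%:E].
  have [|Pn [s sK Gs]] := NK (N + n)%N; first exact: leq_addr.
  by exists s; split => //; exact: strip_tilt.
have [t /all_and2[tK tf]] := choice tilt.
have [r Dr] : exists r : R, D = r%:E.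
  have [f [_ _ Df]] := tf 0%N; exists (fine D); rewrite fineK//.
  by rewrite ge0_fin_numE// (le_lt_trans Df)// ltry.
pose k := expR (- r).
(* Decouples domain and exponent: restricting the [j]-th integral to a smaller fixed strip lowers
   it, so the exponent can converge first. *)
have F_le m j : (m <= N + j)%N ->
    \int[P]_(x in strip m) (expR (- t j * Y x))%:E <= k%:E.
  move=> mj; have [f [f0 fE]] := tf j; rewrite Dr lee_fin lerNr => fr.
  apply: (@le_trans _ _ f%:E); last first.
    by rewrite lee_fin /k -[f]lnK// ler_expR.
  rewrite -fE; apply: ge0_subset_integral => //.
  - exact: measurable_strip.
  - exact: measurable_strip.
  - exact: measfun_EFin.
  - by have /subsetPset := strip_nd mj.
have [s /andP[s0 sK] scl] := cluster_segment tK.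
have iF (m : nat) (u : R) :
    P.-integrable (strip m) (EFin \o (fun x => expR (- u * Y x))%R).
  have := @bounded_laplace_integrable (strip m) (cst 1%R) m%:R 1%R u.
  move=> /(_ (measurable_strip m) (measurable_cst _) (fun=> id)).
  under eq_fun do rewrite mul1r.
  by apply => x _; rewrite normr1.
(* The strip stays fixed while [t j] approaches [s], as continuity in the exponent is only available
   for bounded [Y]; the strip grows afterwards, with [s] fixed. *)
have F_s m : \int[P]_(x in strip m) (expR (- s * Y x))%:E <= k%:E.
  rewrite -[leLHS]fineK; last first.
    by apply: integrable_fin_num; [exact: measurable_strip|exact: iF].
  rewrite lee_fin; apply/ler_addgt0Pr => e e0.
  pose F (u : R) := (\int[P]_(x in strip m) (expR (- u * Y x)))%R.
  have cF : continuous F.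
    have := @continuous_bounded_laplace (strip m) (cst 1%R) m%:R 1%R.
    move=> /(_ (measurable_strip m) (measurable_cst _) (fun=> id)).
    rewrite (_ : (fun u : R => _) = F); last first.
      by apply/funext => u; apply: eq_Rintegral => x _; rewrite mul1r.
    by apply => x _; rewrite normr1.
  have /cvgrPdist_lt/(_ _ e0) := cF s; move=> /(scl _ m)[j mj].
  rewrite -/(F s) => Fsj.
  have : (F (t j) <= k)%R.
    have /F_le : (m <= N + j)%N by rewrite (leq_trans mj)// leq_addl.
    rewrite -[leLHS]fineK//.
    by apply: integrable_fin_num; [exact: measurable_strip|exact: iF].
  move: Fsj; rewrite -/(Rintegral _ _ _) -/(F s) ltr_norml.
  by move: (F s) (F (t j)) => a b; lra.
have Fk : \int[P]_x (expR (- s * Y x))%:E <= k%:E.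
  have := @ge0_nondecreasing_set_cvg_integral _ _ _ strip
    (fun x => (expR (- s * Y x))%:E) P strip_nd measurable_strip.
  move=> /(_ (fun i => measfun_EFin (mexpY s)) (fun _ _ _ => expR_ge0 _)).
  rewrite strip_cover => cvF; rewrite -(cvg_lim _ cvF)//; apply: lime_le.
    by apply/cvg_ex; eexists; exact: cvF.
  by apply: nearW => n; exact: F_s.
pose F := fine (\int[P]_x (expR (- s * Y x))%:E).
have FE : \int[P]_x (expR (- s * Y x))%:E = F%:E.
  by rewrite fineK// ge0_fin_numE ?integral_ge0// (le_lt_trans Fk)// ltry.
have F0 : (0 < F)%R.
  rewrite -lte_fin -FE; apply: expR_integral_gt0 => //.
    exact: measurable_funM.
  by rewrite probability_setT.
exists s, (ln F); split => //; first by rewrite lnK.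
rewrite Dr lee_fin lerNr -[(- r)%R]expRK ler_ln ?posrE ?expR_gt0//.
by rewrite -lee_fin -FE.
Qed.

(* Bernoulli's inequality [s Y exp(- s Y) <= 1 - exp(- s Y)] and Fatou's lemma
   along s = s0 / (n + 2). *)
Lemma laplace_below_one (s0 : R) : (0 < s0)%R ->
  \int[P]_x (expR (- s0 * Y x))%:E < +oo ->
  \int[P]_x (fun x => (Y x)%:E)^\- x < +oo -> 0 < \int[P]_x (Y x)%:E ->
  exists2 s : R, (0 < s)%R & \int[P]_x (expR (- s * Y x))%:E < 1.
Proof.
move=> s00 Z0 Yn Yp.
(* An integrable correction making [f n] nonnegative, as Fatou's lemma demands: if [Y < 0] then
   [- Y <= 2 / s0 * exp(- s0 Y / 2)], and [exp(- s n Y) <= exp(- s0 Y / 2)] because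
   [s n <= s0 / 2]. *)
pose w x := (2 / s0 * expR (- s0 * Y x))%R.
have w0 x : (0 <= w x)%R by rewrite mulr_ge0 ?expR_ge0// divr_ge0// ltW.
have mw : measurable_fun setT w by exact: measurable_funM.
pose s n := (s0 / n.+2%:R)%R.
have s_gt0 n : (0 < s n)%R by rewrite divr_gt0.
have s_le n : (s n <= s0 / 2)%R.
  by rewrite ler_pM2l// lef_pV2 ?posrE// ler_nat.
pose f n x := (Y x * expR (- s n * Y x) + w x)%R.
have mf n : measurable_fun setT (f n).
  by apply: measurable_funD => //; exact: measurable_funM.
have f0 n x : (0 <= f n x)%R.
  have [Yx|Yx] := leP 0%R (Y x); first by rewrite addr_ge0// mulr_ge0// expR_ge0.
  have sz : (expR (- s n * Y x) <= expR (s0 / 2 * - Y x))%R.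
    by rewrite ler_expR mulNr -mulrN ler_wpM2r// oppr_ge0 ltW.
  have zz : (- Y x <= 2 / s0 * expR (s0 / 2 * - Y x))%R.
    rewrite -ler_pdivrMl ?divr_gt0// invf_div.
    by apply: le_trans (expR_ge1Dx _); rewrite lerDr.
  rewrite -lerBlDl sub0r -mulNr /w.
  have -> : (- s0 * Y x = s0 / 2 * - Y x + s0 / 2 * - Y x)%R by field.
  rewrite expRD mulrA ler_pM// ?expR_ge0//.
  by rewrite oppr_ge0 ltW.
have fcvg x : (fun n => (f n x)%:E) @ \oo --> ((Y x + w x)%R)%:E.
  apply: cvg_EFin; first exact: nearW.
  apply: cvgD; last exact: cvg_cst.
  rewrite -[X in _ --> X]mulr1; apply: cvgM; first exact: cvg_cst.
  rewrite -expR0; apply: continuous_cvg; first exact: continuous_expR.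
  rewrite -(mul0r (Y x)); apply: cvgM; last exact: cvg_cst.
  rewrite -oppr0; apply: cvgN; rewrite -(mulr0 s0).
  apply: cvgM; first exact: cvg_cst.
  have := @cvg_harmonic R; rewrite -cvg_shiftS; apply: cvg_trans.
  by apply: near_eq_cvg; apply: nearW.
pose W := \int[P]_x (w x)%:E.
have Wfin : W < +oo.
  rewrite /W; under eq_integral do rewrite EFinM.
  rewrite ge0_integralZl//; last 2 first.
  - exact: measfun_EFin.
  - by rewrite lee_fin divr_ge0// ltW.
  by rewrite lte_mul_pinfty// lee_fin divr_ge0// ltW.
have W0 : 0 <= W by apply: integral_ge0 => x _; rewrite lee_fin.
have Wf : W \is a fin_num by rewrite ge0_fin_numE.
(* Otherwise Fatou's lemma would bound the integral of [Y + w] by that of [w], against the positive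
   mean of [Y]. *)
have [n hn] : exists n, W < \int[P]_x (f n x)%:E.
  apply: contrapT => /forallNP h.
  have : \int[P]_x ((Y x + w x)%R)%:E <= W.
    have := @fatou _ _ _ P setT measurableT (fun n x => (f n x)%:E).
    move=> /(_ (fun n => measfun_EFin (mf n)) (fun n x _ => f0 n x)).
    rewrite (_ : (fun x => limn_einf _) = (fun x => ((Y x + w x)%R)%:E)); last first.
      apply/funext => x; rewrite is_cvg_limn_einfE; last first.
        by apply/cvg_ex; eexists; exact: fcvg.
      by apply/cvg_lim => //; exact: fcvg.
    move=> /le_trans; apply; rewrite limn_einf_lim; apply: lime_le.
      exact: is_cvg_einfs.
    apply: nearW => n; apply: ereal_inf_le.
    exists (\int[P]_x (f n x)%:E); first by exists n => /=.
    by rewrite leNgt; apply/negP/h.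
  rewrite leNgt => /negP; apply.
  have iw : P.-integrable setT (fun x => (w x)%:E).
    by apply: integrable_fin_integral => //; exact: measfun_EFin.
  have [Yoo|Yoo] := eqVneq (\int[P]_x (Y x)%:E) +oo.
    apply: lt_le_trans (_ : +oo <= _); first by rewrite ltey_eq Wf.
    rewrite -Yoo; apply: le_integral_ext => //; [exact: measfun_EFin|exact/measfun_EFin/measurable_funD|].
    by move=> x _; rewrite lee_fin lerDl.
  have iY : P.-integrable setT (fun x => (Y x)%:E).
    by apply: integrable_neg_lty => //; [exact: measfun_EFin|rewrite ltey].
  under eq_integral do rewrite EFinD.
  by rewrite integralD// -/W lteDr.
exists (s n) => //; rewrite ltNge; apply/negP => Z1.
(* Bernoulli's inequality with [s n * w] added to both sides, so that every integrand is
   nonnegative. A transform of at least 1 would make the left side exceed the right by [hn]. *)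
have sW : \int[P]_x (expR (- s n * Y x) + s n * f n x)%:E <=
    \int[P]_x (1 + s n * w x)%:E.
  apply: ge0_le_integral => //.
  - by move=> x _; rewrite lee_fin addr_ge0 ?expR_ge0// mulr_ge0// ltW.
  - by apply: measfun_EFin; apply: measurable_funD => //; exact: measurable_funM.
  - by apply: measfun_EFin; apply: measurable_funD => //; exact: measurable_funM.
  - move=> x _; rewrite lee_fin /f mulrDr addrA lerD2r.
    rewrite mulrA -{1}[expR _]mul1r -mulrDl.
    apply: (@le_trans _ _ (expR (s n * Y x) * expR (- s n * Y x))%R).
      by rewrite ler_wpM2r ?expR_ge0// expR_ge1Dx.
    by rewrite mulNr expRxMexpNx_1.
move: sW; under eq_integral do rewrite EFinD EFinM.
rewrite ge0_integralD//; last 3 first.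
- exact: measfun_EFin.
- by move=> x _; rewrite mule_ge0// lee_fin// ltW.
- by apply: measurable_funeM; exact: measfun_EFin.
rewrite ge0_integralZl//; last 3 first.
- exact: measfun_EFin.
- by move=> x _; rewrite lee_fin.
- by rewrite lee_fin ltW.
under [leRHS]eq_integral do rewrite EFinD EFinM.
rewrite [leRHS]ge0_integralD//; last 2 first.
- by move=> x _; rewrite mule_ge0// lee_fin// ltW.
- by apply: measurable_funeM; exact: measfun_EFin.
rewrite [X in _ <= _ + X]ge0_integralZl//; last 3 first.
- exact: measfun_EFin.
- by move=> x _; rewrite lee_fin.
- by rewrite lee_fin ltW.
rewrite prob_integral_cst leNgt => /negP; apply.
apply: lee_ltD => //.
by rewrite lte_pmul2l ?lte_fin.
Qed.

End laplace.

(** * Relative entropy and weak duality *)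

Section relative_entropy.
Context {d : measure_display} {T : measurableType d} {R : realType}.
Variable P : probability T R.
Implicit Types Q : probability T R.

(** Gibbs' inequality with [h = 0]. The equality case excludes a minimiser when the optimal value is
    0 below the mean. *)
Lemma KL_ge0 Q : Q `<< P ->
  0 <= KL Q P /\ (KL Q P = 0 -> forall B, measurable B -> Q B = P B).
Proof.
move=> QP.
have [KLoo|KLoo] := eqVneq (KL Q P) +oo; first by rewrite KLoo; split.
have := @gibbs _ _ _ P Q setT (cst 0%R) measurableT (measurable_cst _) QP.
rewrite probability_setT => /(_ erefl).
have int1 B : measurable B -> \int[P]_(x in B) (expR (cst 0%R x))%:E = P B.
  by move=> mB; rewrite /= expR0 integral_cst// mul1e.
rewrite int1// probability_setT => /(_ (lexx _)).
rewrite ltey => /(_ KLoo)[_ + +].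
rewrite (_ : (fun x => _) = cst 0)// integral0 => ? KL0; split => // /esym/KL0 Qd B mB.
by rewrite Qd// setIT int1.
Qed.

Lemma KLxx : KL P P = 0.
Proof.
have PP : has_density P P setT (cst 0%R).
  by move=> B mB; rewrite setIT /= expR0 integral_cst// mul1e.
have [-> _] := KL_has_density measurableT (measurable_cst _) PP.
by rewrite integral0_eq.
Qed.

Lemma has_density_unique Q Q' (A : set T) (h : T -> R) :
  has_density P Q A h -> has_density P Q' A h ->
  forall B, measurable B -> Q B = Q' B.
Proof. by move=> QA Q'A B mB; rewrite QA// Q'A. Qed.

Variable X : T -> R.
Hypothesis mX : measurable_fun setT X.

Let mh (s l : R) : measurable_fun setT (fun x => - s * X x - l)%R.
Proof. by apply: measurable_funB => //; exact: measurable_funM. Qed.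

(** Integrating [- s X - l] needs linearity, hence [X] integrable under [Q]. For [s > 0] and finite
    entropy, Gibbs' inequality bounds the positive part of [- s X - l], hence the negative part of
    [X], and the constraint bounds the rest. For [s = 0] the integrand is constant. *)
Lemma dual_bound Q (c s l : R) : Q `<< P -> (0 <= s)%R ->
  \int[P]_x (expR (- s * X x))%:E = (expR l)%:E ->
  \int[Q]_x (X x)%:E <= c%:E ->
  (- s * c - l)%:E <= KL Q P /\
  (KL Q P = (- s * c - l)%:E -> has_density P Q setT (fun x => - s * X x - l)%R).
Proof.
move=> QP s0 Zs Xc.
have [KLoo|KLoo] := eqVneq (KL Q P) +oo; first by rewrite KLoo; split; rewrite ?leey.
have h1 : \int[P]_x (expR (- s * X x - l))%:E = 1.
  under eq_integral do rewrite expRB EFinM.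
  rewrite ge0_integralZr//; last first.
    by apply: measfun_EFin; apply: measurableT_comp => //; exact: measurable_funM.
  by rewrite Zs -EFinM divff// gt_eqF ?expR_gt0.
have := gibbs measurableT (mh s l) QP (probability_setT Q).
rewrite h1 => /(_ (lexx _)); rewrite ltey => /(_ KLoo)[hp hle heq].
suff hc : (- s * c - l)%:E <= \int[Q]_x (- s * X x - l)%:E.
  split; first exact: le_trans hle.
  by move=> KLE; apply: heq; apply/eqP; rewrite eq_le hle KLE hc.
move: s0; rewrite le_eqVlt => /predU1P[<-|s0].
  under eq_integral do rewrite oppr0 mul0r.
  by rewrite prob_integral_cst oppr0 mul0r.
have iX : Q.-integrable setT (EFin \o X).
  apply: integrable_neg_lty => //; [exact: measfun_EFin| |by rewrite (le_lt_trans Xc)// ltry].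
  apply: (@le_lt_trans _ _ (\int[Q]_x
      (s^-1%:E * ((fun x => (- s * X x - l)%:E)^\+ x + `|l|%:E)))).
    apply: ge0_le_integral => //.
    - by apply: measurable_funeneg; exact: measfun_EFin.
    - apply: measurable_funeM; apply: emeasurable_funD => //.
      by apply: measurable_funepos; exact: measfun_EFin.
    - move=> x _; rewrite funenegE funeposE /comp -EFinN -!EFin_max -EFinD -EFinM lee_fin.
      rewrite ler_pdivlMl// maxr_pMr ?(ltW s0)// mulr0 ge_max; apply/andP; split.
        by rewrite mulrN -mulNr -lerBlDr le_max lerD2l lerN2 ler_norm.
      by rewrite addr_ge0// le_max lexx orbT.
  rewrite ge0_integralZl//; last 3 first.
  - by apply: emeasurable_funD => //; apply: measurable_funepos; exact: measfun_EFin.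
  - by move=> x _; rewrite adde_ge0.
  - by rewrite lee_fin invr_ge0 ltW.
  rewrite ge0_integralD//; last by apply: measurable_funepos; exact: measfun_EFin.
  by rewrite lte_mul_pinfty ?lee_fin ?invr_ge0 ?(ltW s0)// prob_integral_cst lte_add_pinfty ?ltry.
rewrite (_ : (fun x => (- s * X x - l)%:E) =
    (fun x => (- s)%:E * (X x)%:E - l%:E)); last exact/funext.
rewrite integralB//; last 2 first.
- exact: (integrableZl measurableT).
- exact: finite_measure_integrable_cst.
rewrite integralZl// prob_integral_cst.
move: (integrable_fin_num measurableT iX) Xc; rewrite /comp.
case: integral => // x _; rewrite lee_fin => xc.
by rewrite -EFinM -EFinB lee_fin lerD2r !mulNr lerN2 ler_wpM2l// ltW.
Qed.

(** The excess [g = max(X - b, 0)] is nonnegative everywhere, agrees with [X - b] almost surely and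
    has integral at most 0. *)
Lemma ae_eq_lower_bound Q (b : R) : {ae Q, forall x, (b <= X x)%R} ->
  \int[Q]_x (X x)%:E <= b%:E -> {ae Q, forall x, X x = b}.
Proof.
move=> bX Xb; pose g x := Num.max (X x - b)%R 0%R.
have mg : measurable_fun setT g.
  by apply: measurable_maxr => //; exact: measurable_funB.
have g0 x : (0 <= g x)%R by rewrite le_max lexx orbT.
have mgb : measurable_fun setT (fun x => g x + b)%R by exact: measurable_funD.
have gX : \int[Q]_x (g x + b)%:E = \int[Q]_x (X x)%:E.
  apply: ae_eq_integral => //; [exact: measfun_EFin|exact: measfun_EFin|].
  apply: filterS bX => x bx _; congr EFin.
  by rewrite /g (max_idPl _) ?subr_ge0// subrK.
have igb : Q.-integrable setT (fun x => (g x + b)%:E).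
  apply: integrable_neg_lty => //; [exact: measfun_EFin| |by rewrite gX (le_lt_trans Xb)// ltry].
  apply: (@le_lt_trans _ _ (\int[Q]_x `|b|%:E)); last first.
    by rewrite prob_integral_cst ltry.
  apply: ge0_le_integral => //.
  - by apply: measurable_funeneg; exact: measfun_EFin.
  - move=> x _; rewrite funenegE -EFinN -EFin_max lee_fin ge_max normr_ge0 andbT.
    by rewrite opprD -normrN (le_trans _ (ler_norm _))// gerDr oppr_le0.
have ib : Q.-integrable setT (fun=> b%:E) by exact: finite_measure_integrable_cst.
have gint0 : \int[Q]_x (g x)%:E <= 0.
  rewrite (_ : (fun x => (g x)%:E) = (fun x => (g x + b)%:E - b%:E)); last first.
    by apply/funext => x; rewrite -EFinB addrK.
  by rewrite integralB// gX prob_integral_cst sube_le0.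
have : \int[Q]_x `|(g x)%:E| = 0.
  apply/eqP; rewrite eq_le integral_ge0// andbT.
  by under eq_integral do rewrite gee0_abs ?lee_fin//.
move=> /(ae_eq_integral_abs Q measurableT (measfun_EFin mg)) gae.
apply: filterS2 bX gae => x bx /(_ I)[].
rewrite /g (max_idPl _) ?subr_ge0// => /eqP.
by rewrite subr_eq0 => /eqP.
Qed.

End relative_entropy.

(** * From [log E] to a real variable; weak and strong duality for it *)

Section log_evariable.
Context {d : measure_display} {T : measurableType d} {R : realType}.
Variables (P : probability T R) (E : {RV P >-> \bar R}).
Hypothesis E01 : P [set x | 0 < E x < +oo] = 1.
Implicit Types Q : probability T R.

(* Meaningless outside of [0 < E x < +oo], whose complement is P-null. *)
Definition logR (x : T) : R := ln (fine (E x)).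
Local Notation X := logR.

Lemma measurable_logR : measurable_fun setT logR.
Proof.
apply: measurableT_comp => //; apply: measurableT_comp => //.
Qed.
Let mX := measurable_logR.

Let ae_good : {ae P, forall x, 0 < E x < +oo}.
Proof.
have mE : measurable [set x | 0 < E x < +oo].
  rewrite (_ : [set x | _] = E @^-1` [set` Interval (BRight 0) (BLeft +oo)]); last first.
    by apply/seteqP; split => x /=; rewrite in_itv.
  exact: (measurable_funPTI E (emeasurable_itv _)).
exists (~` [set x | 0 < E x < +oo]); split => //; first exact: measurableC.
exact: prob1_negligible.
Qed.

Lemma logE_logR : {ae P, forall x, logE E x = (X x)%:E}.
Proof.
apply: filterS ae_good => x; rewrite /logE /logR.
case: (E x) => [r| |]//=; rewrite ?ltxx ?andbF//.
by rewrite lte_fin => /andP[r0 _]; rewrite leNgt r0.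
Qed.

Lemma integral_logE Q : Q `<< P -> \int[Q]_x logE E x = \int[Q]_x (X x)%:E.
Proof.
move=> QP; apply: ae_eq_integral => //; [exact: measurable_logE|exact: measfun_EFin|].
by apply: filterS (null_dominates_ae QP logE_logR) => x + _.
Qed.

Lemma integral_tilt s : \int[P]_x (E x `^ (- s)) = \int[P]_x (expR (- s * X x))%:E.
Proof.
apply: ae_eq_integral => //; first exact: measurable_tilt.
  by apply: measfun_EFin; apply: measurableT_comp => //; exact: measurable_funM.
apply: filterS ae_good => x + _; rewrite /logR.
case: (E x) => [r| |]//=; rewrite ?ltxx ?andbF//.
by rewrite lte_fin => /andP[r0 _]; rewrite /powR gt_eqF.
Qed.

Lemma Lambda_fin s : Lambda E s < +oo -> exists2 l : R, Lambda E s = l%:E &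
  \int[P]_x (expR (- s * X x))%:E = (expR l)%:E.
Proof.
move=> Ls; have := Lambda_gtNy E01 s; rewrite -integral_tilt.
move: Ls; rewrite /Lambda.
case: integral => [r| |]//=; case: ifPn => // r0 _ _.
by exists (ln r) => //; rewrite lnK// posrE ltNge.
Qed.

Lemma LambdaE s l : \int[P]_x (expR (- s * X x))%:E = (expR l)%:E ->
  Lambda E s = l%:E.
Proof. by move=> Zs; rewrite /Lambda integral_tilt Zs lne_EFin ?expR_gt0// expRK. Qed.

Lemma Lambda0 : Lambda E 0 = 0.
Proof.
apply: LambdaE; rewrite expR0 -[RHS](prob_integral_cst P).
by apply: eq_integral => x _; rewrite oppr0 mul0r expR0.
Qed.

Lemma tilted_density s l : Lambda E s = l%:E ->
  has_density P (tilted_law E s) setT (fun x => - s * X x - l)%R.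
Proof.
move=> Ls B mB; rewrite tilted_lawE ?Ls ?ltry// setIT.
apply: ae_eq_integral => //.
- apply: emeasurable_funM => //; apply: measurable_funTS; exact: measurable_tilt.
- apply: measfun_EFin; apply: measurableT_comp => //.
  by apply: measurable_funB => //; exact: measurable_funM.
apply: filterS ae_good => x + _; rewrite /logR expRB.
case: (E x) => [r| |]//=; rewrite ?ltxx ?andbF//.
rewrite lte_fin => /andP[r0 _]; rewrite /powR gt_eqF//.
by rewrite -EFinM expRN.
Qed.

Lemma x0_le_logR : {ae P, forall x, x0 E <= (X x)%:E}.
Proof.
by apply: filterS2 (ess_inf_le P (logE E)) logE_logR => x ? <-.
Qed.

Lemma x0_lty : x0 E < +oo.
Proof.
rewrite ltey; apply/eqP => x0y.
have : {ae P, forall x : T, False}.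
  by apply: filterS x0_le_logR => x; rewrite x0y leye_eq.
move=> [N [mN N0 sN]].
have : P setT <= P N.
  by rewrite le_measure ?inE//; apply: subset_trans sN => x _.
by rewrite N0 probability_setT lee_fin ler10.
Qed.

Lemma x0_lt_neq0 c : x0 E < c%:E -> P [set x | (X x < c)%R] != 0.
Proof.
move=> x0c; apply/eqP => P0.
suff : c%:E <= x0 E by rewrite leNgt x0c.
apply/ess_infP; have ae2 : {ae P, forall x, (c <= X x)%R}.
  exists [set x | (X x < c)%R]; split => //.
    rewrite (_ : [set x | _] = X @^-1` `]-oo, c[%classic)//.
    by rewrite -[X in measurable X]setTI; exact: mX.
  by move=> x /= /negP; rewrite -ltNge.
by apply: filterS2 logE_logR ae2 => x ->; rewrite lee_fin.
Qed.

Lemma Jsup_ge c s l : (0 <= s)%R -> Lambda E s = l%:E ->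
  (- s * c - l)%:E <= Jsup E c.
Proof.
by move=> s0 Ls; apply: ereal_sup_ubound; exists s => //; rewrite Ls -EFinB.
Qed.

Lemma Jsup_ge0 c : 0 <= Jsup E c.
Proof.
have := @Jsup_ge c 0%R 0%R (lexx _) Lambda0.
by rewrite oppr0 mul0r addr0.
Qed.

Lemma Jsup_le_KL c Q : admissible E c Q -> Jsup E c <= KL Q P.
Proof.
move=> [QP _ Xc]; apply: ge_ereal_sup => _ [s /= s0 <-].
have [Loo|] := eqVneq (Lambda E s) +oo.
  by rewrite Loo addeC/= leNye.
rewrite -ltey => /Lambda_fin[l -> Zl]; rewrite -EFinB.
have {}Xc : \int[Q]_x (X x)%:E <= c%:E by rewrite -integral_logE.
by have [] := dual_bound mX QP s0 Zl Xc.
Qed.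

Lemma Jsup_le_Dinf c : Jsup E c <= Dinf E c.
Proof. by apply: le_ereal_inf_tmp => _ [Q Qc <-]; exact: Jsup_le_KL. Qed.

Lemma Dinf_le_KL c Q : admissible E c Q -> Dinf E c <= KL Q P.
Proof. by move=> Qc; apply: ereal_inf_lbound; exists Q. Qed.

Lemma admissible_integrable c Q : Q `<< P -> Q.-integrable setT (EFin \o X) ->
  \int[Q]_x (X x)%:E <= c%:E -> admissible E c Q.
Proof.
move=> QP iX Xc; split => //; last by rewrite integral_logE.
left; apply: (@le_lt_trans _ _ (\int[Q]_x (EFin \o X)^\+ x)); last first.
  exact: integral_funepos_lt_pinfty.
rewrite le_eqVlt; apply/orP; left; apply/eqP.
apply: ae_eq_integral => //.
- by apply: measurable_funepos; exact: measurable_logE.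
- by apply: measurable_funepos; exact: measfun_EFin.
apply: filterS (null_dominates_ae QP logE_logR) => x xE _.
by rewrite !funeposE xE.
Qed.

Section centered.
Hypothesis mu_gtNy : -oo < \int[P]_x logE E x.
Variable c : R.
Hypothesis cmu : c%:E < \int[P]_x logE E x.

Let Y x := (X x - c)%R.
Let mY : measurable_fun setT Y. Proof. exact: measurable_funB. Qed.

Let XP : \int[P]_x (fun x => (X x)%:E)^\- x < +oo.
Proof.
rewrite ltey; apply/eqP => Xy; move: mu_gtNy.
by rewrite integral_logE// integralE Xy addeC.
Qed.

Let Yn : \int[P]_x (fun x => (Y x)%:E)^\- x < +oo.
Proof.
apply: (@le_lt_trans _ _ (\int[P]_x ((fun x => (X x)%:E)^\- x + `|c|%:E))).
  apply: ge0_le_integral => //.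
  - by apply: measurable_funeneg; exact: measfun_EFin.
  - by apply: emeasurable_funD => //; apply: measurable_funeneg; exact: measfun_EFin.
  move=> x _; rewrite !funenegE -!EFinN -!EFin_max -EFinD lee_fin /Y ge_max.
  rewrite opprB addrC lerD ?ler_norm ?le_max ?lexx//=.
  by rewrite addr_ge0// le_max lexx orbT.
rewrite ge0_integralD//; last by apply: measurable_funeneg; exact: measfun_EFin.
by rewrite prob_integral_cst lte_add_pinfty ?ltry.
Qed.

(** By contradiction, since the mean of [log E] may be [+oo]: a nonpositive mean of [Y] makes [Y]
    integrable, and linearity then puts the mean of [log E] at or below [c]. *)
Let Yp : 0 < \int[P]_x (Y x)%:E.
Proof.
rewrite ltNge; apply/negP => Y0; move: cmu; rewrite integral_logE//.
have iY : P.-integrable setT (EFin \o Y).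
  by apply: integrable_neg_lty => //; [exact: measfun_EFin|exact: le_lt_trans Y0 (ltry _)].
rewrite (_ : (fun x => (X x)%:E) = (fun x => (Y x)%:E + c%:E)); last first.
  by apply/funext => x; rewrite -EFinD subrK.
rewrite integralD//; last exact: finite_measure_integrable_cst.
rewrite prob_integral_cst ltNge => /negP; apply.
by rewrite -[leRHS]add0e; exact: leeD2r.
Qed.

Lemma integral_centered s l : \int[P]_x (expR (- s * Y x))%:E = (expR l)%:E ->
  \int[P]_x (expR (- s * X x))%:E = (expR (l - s * c))%:E.
Proof.
move=> Zl; rewrite expRB -expRN EFinM -Zl -ge0_integralZr//; last first.
  by apply: measfun_EFin; apply: measurableT_comp => //; exact: measurable_funM.
apply: eq_integral => x _; rewrite -EFinM -expRD; congr (expR _)%:E.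
by rewrite /Y; ring.
Qed.

(** Laws under which [Y] has mean 0 are admissible, so the primal infimum is a valid [D]; it is then
    squeezed between the dual term at [s] and the dual supremum. The maximiser [s] is kept in the
    conclusion because non-attainment and the form of minimisers are read off from it. *)
Lemma strong_duality : x0 E < c%:E -> exists s l : R,
  [/\ (0 <= s)%R, Lambda E s = l%:E, Dinf E c = (- s * c - l)%:E &
      Jsup E c = Dinf E c].
Proof.
move=> x0c.
have D0 : 0 <= Dinf E c by rewrite (le_trans (Jsup_ge0 c))// Jsup_le_Dinf.
have DKL Q : Q `<< P -> Q.-integrable setT (EFin \o Y) ->
    \int[Q]_x (Y x)%:E = 0 -> Dinf E c <= KL Q P.
  move=> QP iY Y0; apply: Dinf_le_KL.
  have ic : Q.-integrable setT (fun=> c%:E) by exact: finite_measure_integrable_cst.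
  have XE : EFin \o X = (EFin \o Y) \+ (fun=> c%:E).
    by apply/funext => x /=; rewrite -EFinD subrK.
  apply: admissible_integrable => //; first by rewrite XE; exact: integrableD.
  have -> : \int[Q]_x (X x)%:E = \int[Q]_x ((Y x)%:E + c%:E).
    by apply: eq_integral => x _; rewrite -EFinD subrK.
  by rewrite integralD// Y0 prob_integral_cst add0e.
have Yneg : P [set x | (Y x < 0)%R] != 0.
  by under eq_set do rewrite /Y subr_lt0; exact: x0_lt_neq0.
have [s [l [s0 Zl Dl]]] := dual_attained mY D0 DKL Yneg Yn Yp.
have Ls := LambdaE (integral_centered Zl).
have Jl := Jsup_ge c s0 Ls.
have DJ : Dinf E c <= (- s * c - (l - s * c))%:E.
  by rewrite (_ : (- s * c - _)%R = (- l)%R)//; ring.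
exists s, (l - s * c)%R; split => //; apply/eqP; rewrite eq_le.
  by rewrite DJ (le_trans Jl)// Jsup_le_Dinf.
by rewrite Jsup_le_Dinf (le_trans DJ).
Qed.

(** The dual term at [s] is minus the logarithm of the Laplace transform of [Y], so a value of that
    transform below 1 suffices. *)
Lemma Jsup_gt0 : 0 < s_max E -> 0 < Jsup E c.
Proof.
move=> /ereal_sup_gt[_ [s0 [s0_ge0 Ls0] <-]]; rewrite lte_fin => s0_gt0.
have [l0 _ Zl0] := Lambda_fin Ls0.
have ZY s : \int[P]_x (expR (- s * Y x))%:E =
    \int[P]_x (expR (- s * X x))%:E * (expR (s * c))%:E.
  rewrite -ge0_integralZr//; last first.
    by apply: measfun_EFin; apply: measurableT_comp => //; exact: measurable_funM.
  apply: eq_integral => x _; rewrite -EFinM -expRD; congr (expR _)%:E.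
  by rewrite /Y; ring.
have [|s s_gt0 Zs] := laplace_below_one mY s0_gt0 _ Yn Yp.
  by rewrite ZY Zl0 -EFinM ltry.
have Z0 : 0 < \int[P]_x (expR (- s * Y x))%:E.
  by apply: expR_integral_gt0 => //; [exact: measurable_funM|rewrite probability_setT].
have [l Zl] : exists l, \int[P]_x (expR (- s * Y x))%:E = (expR l)%:E.
  move: Z0 Zs; case: integral => [r| |]// r0 _.
  by exists (ln r); rewrite lnK.
have Jl := Jsup_ge c (ltW s_gt0) (LambdaE (integral_centered Zl)).
apply: lt_le_trans Jl.
rewrite lte_fin (_ : (- s * c - _)%R = (- l)%R); last by ring.
by move: Zs; rewrite Zl lte_fin expR_lt1 oppr_gt0.
Qed.

End centered.

End log_evariable.

(** * The regimes of [c] relative to [x0] and the mean *)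

Section regimes.
Context {d : measure_display} {T : measurableType d} {R : realType}.
Variables (P : probability T R) (E : {RV P >-> \bar R}).
Hypothesis E01 : P [set x | 0 < E x < +oo] = 1.
Implicit Types Q : probability T R.
Local Notation X := (logR E).

Let mX : measurable_fun setT X := measurable_logR E.

Lemma minimizer_above_mean c : expectation_defined P (logE E) ->
  \int[P]_x logE E x <= c%:E ->
  [/\ Jsup E c = 0, Dinf E c = 0 & minimizer E c P].
Proof.
move=> mu_def muc.
have Pc : admissible E c P by split => //; exact: null_dominates_refl.
have D0 : Dinf E c <= 0 by rewrite -(KLxx P) Dinf_le_KL.
have J0 := Jsup_ge0 E01 c; have JD := Jsup_le_Dinf E01 c.
have DE : Dinf E c = 0 by apply/eqP; rewrite eq_le D0 (le_trans J0).
split => //; last by split; rewrite // KLxx DE.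
by apply/eqP; rewrite eq_le J0 -DE JD.
Qed.

Section lower_bound.
Variables (b : R) (bE : x0 E = b%:E).

Let bX : {ae P, forall x, (b <= X x)%R}.
Proof. by apply: filterS (x0_le_logR E01) => x; rewrite bE lee_fin. Qed.

(** Values almost surely at least [b] with mean at most [b] are equal to [b], which also pins down
    [c]. For [c < b] this is the contradiction that empties the admissible set; for [c = b] it
    locates the admissible laws. *)
Lemma admissible_concentrated c Q : (c <= b)%R -> admissible E c Q ->
  {ae Q, forall x, X x = b} /\ c = b.
Proof.
move=> cb [QP _]; rewrite (integral_logE E01 QP) => Xc.
have Xb := ae_eq_lower_bound mX (null_dominates_ae QP bX)
  (le_trans Xc (_ : c%:E <= b%:E)).
have {}Xb : {ae Q, forall x, X x = b} by apply: Xb; rewrite lee_fin.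
split => //; apply/eqP; rewrite eq_le cb -lee_fin -(prob_integral_cst Q b).
apply: le_trans Xc; rewrite le_eqVlt; apply/orP; left; apply/eqP.
apply: ae_eq_integral => //; first exact: measfun_EFin.
by apply: filterS Xb => x ->.
Qed.

Lemma duality_below_x0 c : (c < b)%R ->
  [/\ admissible E c = set0, Jsup E c = +oo & Dinf E c = +oo].
Proof.
move=> cb.
have A0 : admissible E c = set0.
  rewrite -subset0 => Q /(admissible_concentrated (ltW cb))[_ cE].
  by move: cb; rewrite cE ltxx.
split => //; last by rewrite /Dinf A0 image_set0 ereal_inf0.
(* Since [X >= b] gives [Lambda(s) <= - s b], the dual term at [s] is at least [s (b - c)], which
   this [s] makes equal to [r]. *)
apply/eqyP => r r0; pose s := (r / (b - c))%R.
have bc0 : (0 < b - c)%R by rewrite subr_gt0.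
have s0 : (0 <= s)%R by rewrite divr_ge0// ltW.
have mexp : measurable_fun setT (fun x => (expR (- s * X x))%:E).
  by apply: measfun_EFin; apply: measurableT_comp => //; exact: measurable_funM.
have Zb : \int[P]_x (expR (- s * X x))%:E <= (expR (- s * b))%:E.
  rewrite -(prob_integral_cst P); apply: ae_ge0_le_integral => //.
  apply: filterS bX => x bx _; rewrite lee_fin ler_expR !mulNr lerN2.
  by rewrite ler_wpM2l.
have [|l Ls Zl] := Lambda_fin E01 (s := s).
  rewrite /Lambda integral_tilt//; move: Zb; case: integral => [z| |]//= _.
  by case: ifP; rewrite ?ltNyr ?ltry.
apply: le_trans (Jsup_ge c s0 Ls).
move: Zb; rewrite Zl !lee_fin ler_expR => lsb.
have -> : r = (s * (b - c))%R by rewrite divfK// gt_eqF.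
by lra.
Qed.

(* [exp(- n (X - b))] decreases to the indicator of [X = b]. *)
Lemma x0_event_ge (r : R) : Jsup E b <= r%:E -> (expR (- r))%:E <= P (x0_event E).
Proof.
move=> Jr.
pose f (n : nat) x := expR (- n%:R * (X x - b)).
have mf n : measurable_fun setT (f n).
  by apply: measurableT_comp => //; apply: measurable_funM => //; exact: measurable_funB.
have fr n : (expR (- r))%:E <= \int[P]_x (f n x)%:E.
  have [->|] := eqVneq (\int[P]_x (f n x)%:E) +oo; first exact: leey.
  have f0 : 0 < \int[P]_x (f n x)%:E.
    apply: expR_integral_gt0 => //; last by rewrite probability_setT.
    by apply: measurable_funM => //; exact: measurable_funB.
  rewrite -ltey => foo.
  have [l Zl] : exists l, \int[P]_x (f n x)%:E = (expR l)%:E.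
    move: f0 foo; case: integral => [z| |]// z0 _.
    by exists (ln z); rewrite lnK.
  (* The dual term at [s = n] is minus the logarithm of the integral of [f n]. *)
  have := Jsup_ge b (ler0n R n) (LambdaE E01 (integral_centered Zl)).
  move=> /le_trans/(_ Jr); rewrite Zl !lee_fin ler_expR; lra.
have cvgf : \int[P]_x (f n x)%:E @[n --> \oo] --> \int[P]_x (\1_(x0_event E) x)%:E.
  have [] := @dominated_convergence _ _ _ P setT measurableT
    (fun n x => (f n x)%:E) (fun x => (\1_(x0_event E) x)%:E) (cst 1).
  - by move=> n; exact: measfun_EFin.
  - by apply: measfun_EFin; exact: measurable_indic (measurable_x0_event E).
  - apply: filterS2 bX (logE_logR E01) => x bx xE _.
    rewrite indicE; have [xb|xb] := eqVneq (X x) b.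
      rewrite mem_set; last by rewrite /x0_event/= xE bE xb.
      apply: cvg_near_cst; apply: nearW => n.
      by rewrite /f xb subrr mulr0 expR0.
    rewrite memNset; last first.
      by rewrite /x0_event/= xE bE => -[] /eqP; rewrite (negbTE xb).
    have Xb0 : (0 < X x - b)%R by rewrite subr_gt0 lt_neqAle eq_sym xb.
    apply: cvg_EFin; first exact: nearW.
    have q1 : (`|expR (- (X x - b))| < 1)%R.
      by rewrite ger0_norm ?expR_ge0// expR_lt1 oppr_lt0.
    rewrite (_ : _ \o _ = (fun n => expR (- (X x - b)) ^+ n)%R); last first.
      apply/funext => n /=; rewrite /f -expRM_natl; congr expR; ring.
    exact: cvg_expr.
  - exact: finite_measure_integrable_cst.
  - apply: filterS bX => x bx n _.
    rewrite gee0_abs ?lee_fin ?expR_ge0// -expR0 ler_expR.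
    by rewrite mulNr oppr_le0 mulr_ge0// subr_ge0.
  by [].
rewrite integral_indic// in cvgf; last exact: measurable_x0_event.
rewrite setIT in cvgf.
rewrite -(cvg_lim _ cvgf)//; apply: lime_ge; last exact: nearW.
by apply/cvg_ex; eexists; exact: cvgf.
Qed.

Let mA := measurable_x0_event E.

Lemma x0_event_full Q : admissible E b Q -> Q (x0_event E) = 1.
Proof.
move=> Qb; have [Xb _] := admissible_concentrated (lexx b) Qb.
have [QP _ _] := Qb.
rewrite -(probability_setT Q); apply/eqP; rewrite eq_le.
rewrite le_measure ?inE//=; have : {ae Q, forall x, x0_event E x}.
  apply: filterS2 Xb (null_dominates_ae QP (logE_logR E01)) => x xb xE.
  by rewrite /x0_event/= xE bE xb.
move=> [N [mN N0 sN]].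
rewrite -[leRHS]adde0 -N0 (le_trans _ (measureU2 _ _ _))//.
apply: le_measure; rewrite ?inE//; first exact: measurableU.
by move=> x _; have [Ax|nAx] := pselect (x0_event E x); [left|right; exact: sN].
Qed.

(** An admissible law gives the event mass 1, which absolute continuity forbids when the event is
    [P]-null. *)
Lemma minimizer_x0_event Q : admissible E b Q -> 0 < P (x0_event E).
Proof.
move=> Qb; have [/null_content_dominatesP QP _ _] := Qb.
rewrite lt_neqAle measure_ge0 andbT eq_sym; apply/eqP => PA0.
have := x0_event_full Qb; rewrite QP// => /eqP.
by rewrite eq_sym onee_eq0.
Qed.

Section charged.
Variables (p : R) (p0 : (0 < p)%R) (pE : P (x0_event E) = p%:E).

Let mlnp : measurable_fun [set: T] (cst (- ln p)%R). Proof. exact: measurable_cst. Qed.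

Lemma x0_law_density : has_density P (x0_law E) (x0_event E) (cst (- ln p)%R).
Proof.
move=> B mB; rewrite x0_lawE ?pE ?lte_fin//.
rewrite /= expRN lnK// prob_integral_cst_in; last exact: measurableI.
by rewrite muleC inver gt_eqF.
Qed.

Let KLx0 : KL (x0_law E) P = (- ln p)%:E.
Proof.
have [-> _] := KL_has_density mA mlnp x0_law_density.
exact: prob_integral_cst.
Qed.

Lemma x0_law_admissible : admissible E b (x0_law E).
Proof.
have QP := has_density_null mA mlnp x0_law_density.
have Q1 := has_density_mass mA x0_law_density.
have Xb : {ae x0_law E, forall x, (b = X x)%R}.
  have aeA : {ae x0_law E, forall x, x0_event E x}.
    exists (~` x0_event E); split => //; first exact: measurableC.
    exact: prob1_negligible.
  apply: filterS2 aeA (null_dominates_ae QP (logE_logR E01)) => x.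
  by rewrite /x0_event/= bE => -> [].
have XE : \int[x0_law E]_x (X x)%:E = b%:E.
  rewrite -[RHS](prob_integral_cst (x0_law E)).
  apply: ae_eq_integral => //; first exact: measfun_EFin.
  by apply: filterS Xb => x ->.
have ib : (x0_law E).-integrable setT (EFin \o X).
  by apply: integrable_fin_integral => //; [exact: measfun_EFin|rewrite XE].
by apply: (admissible_integrable E01 QP ib); rewrite XE.
Qed.

(** The conditional law has entropy [- ln p], bounding the infimum above; [exp(- J) <= p], obtained
    along [s = n], bounds the supremum [J] below. *)
Lemma duality_charged : Dinf E b = (- ln p)%:E /\ Jsup E b = (- ln p)%:E.
Proof.
have D_le : Dinf E b <= (- ln p)%:E.
  by rewrite -KLx0; exact: Dinf_le_KL x0_law_admissible.
have JD := Jsup_le_Dinf E01 b.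
suff J_ge : (- ln p)%:E <= Jsup E b.
  split; apply/eqP; rewrite eq_le; first by rewrite D_le (le_trans J_ge).
  by rewrite J_ge (le_trans JD).
have : Jsup E b \is a fin_num.
  by rewrite ge0_fin_numE ?Jsup_ge0// (le_lt_trans JD)// (le_lt_trans D_le)// ltry.
move=> /fineK JE; have := x0_event_ge (r := fine (Jsup E b)).
rewrite JE => /(_ (lexx _)); rewrite pE lee_fin -JE lee_fin => pr.
by rewrite lerNl -[leLHS]expRK ler_ln ?posrE ?expR_gt0.
Qed.

Lemma x0_law_unique_minimizer : unique_minimizer E b (x0_law E).
Proof.
have [DE _] := duality_charged.
split; first by split; [exact: x0_law_admissible|rewrite DE].
move=> Q [Qb KLQ] B mB; rewrite DE in KLQ.
have [QP _ _] := Qb; have QA := x0_event_full Qb.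
have int1 : \int[P]_(x in x0_event E) (expR (cst (- ln p)%R x))%:E = 1.
  by rewrite /= expRN lnK// prob_integral_cst_in// pE -EFinM mulVf// gt_eqF.
have := gibbs mA mlnp QP QA; rewrite int1 KLQ => /(_ (lexx _) (ltry _))[_ _ Qd].
apply: has_density_unique (Qd _) x0_law_density _ mB.
by rewrite prob_integral_cst_in// QA mule1.
Qed.

End charged.

Lemma duality_x0 :
  [/\ Jsup E b = lne (1 / P (x0_event E)),
      Dinf E b = lne (1 / P (x0_event E)),
      (exists Q, minimizer E b Q) <-> 0 < P (x0_event E) &
      0 < P (x0_event E) -> unique_minimizer E b (x0_law E)].
Proof.
have pE : P (x0_event E) = (fine (P (x0_event E)))%:E.
  by rewrite fineK// fin_num_measure.
have uniq : 0 < P (x0_event E) -> unique_minimizer E b (x0_law E).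
  by rewrite {1}pE lte_fin => p0; exact: x0_law_unique_minimizer p0 pE.
have [p0|p0] := pselect (0 < P (x0_event E)); last first.
  have PA0 : P (x0_event E) = 0.
    by apply/eqP; rewrite -measure_le0 leNgt; exact/negP.
  have Joo : Jsup E b = +oo.
    have := Jsup_ge0 E01 b; case JE : (Jsup E b) => [r| |]// _.
    have := x0_event_ge (r := r); rewrite JE => /(_ (lexx _)).
    by rewrite PA0 lee_fin leNgt expR_gt0.
  have Doo : Dinf E b = +oo.
    by apply/eqP; rewrite -leye_eq -Joo Jsup_le_Dinf.
  (* The inverse of 0 is [+oo] in the extended reals, and so is its logarithm: the convention for
     [log(1/0)] holds by evaluation. *)
  rewrite [in lne _]PA0 inve0 mul1e Joo Doo; split => //; split => //.
  by move=> [Q [Qb _]]; exact: minimizer_x0_event Qb.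
have lnE : lne (1 / P (x0_event E)) = (- ln (fine (P (x0_event E))))%:E.
  have p0' : (0 < fine (P (x0_event E)))%R by rewrite -lte_fin -pE.
  by rewrite [in LHS]pE mul1e inver gt_eqF// lne_EFin ?invr_gt0// lnV.
have p0' : (0 < fine (P (x0_event E)))%R by rewrite -lte_fin -pE.
have [DE JE] := duality_charged p0' pE.
rewrite lnE; split => //; split => // _.
by exists (x0_law E); have [] := uniq p0.
Qed.

End lower_bound.

Section between.
Hypothesis mu_gtNy : -oo < \int[P]_x logE E x.
Variable c : R.
Hypotheses (x0c : x0 E < c%:E) (cmu : c%:E < \int[P]_x logE E x).

(** The dual maximiser has finite [Lambda], hence is 0, and the common value is 0. A minimiser would
    have zero entropy and so coincide with [P], whose mean exceeds [c]. *)
Lemma duality_no_tilt : s_max E = 0 ->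
  [/\ Jsup E c = 0, Dinf E c = 0 & ~ exists Q, minimizer E c Q].
Proof.
move=> sm0; have [s [l [s0 Ls DE JD]]] := strong_duality E01 mu_gtNy cmu x0c.
have s_eq0 : s = 0%R.
  have : s%:E <= s_max E.
    by apply: ereal_sup_ubound; exists s => //; split => //; rewrite Ls ltry.
  by rewrite sm0 lee_fin => s_le0; apply/eqP; rewrite eq_le s0 s_le0.
have D0 : Dinf E c = 0.
  move: Ls; rewrite s_eq0 Lambda0// => -[l0].
  by rewrite DE s_eq0 -l0 oppr0 mul0r addr0.
split; [by rewrite JD|by []|move=> [Q [[QP _ Qc] KLQ]]].
have [_ QE] := KL_ge0 QP; rewrite D0 in KLQ.
move: cmu; rewrite ltNge => /negP; apply.
by rewrite (eq_measure_integral Q)// => B mB _; exact/esym/QE.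
Qed.

(** When the tilted mean is exactly [c], the entropy of the tilted law is itself a dual term, so
    weak duality makes it optimal; uniqueness is the equality case of that bound. *)
Lemma tilted_minimizer s : (0 <= s)%R -> Lambda E s < +oo ->
  tilted_mean E s = c%:E ->
  [/\ unique_minimizer E c (tilted_law E s), Dinf E c = KL (tilted_law E s) P &
      KL (tilted_law E s) P = (- s * c)%:E - Lambda E s].
Proof.
move=> s0 /(Lambda_fin E01)[l Ls Zl]; rewrite /tilted_mean => mc.
have mh : measurable_fun setT (fun x => - s * X x - l)%R.
  by apply: measurable_funB => //; exact: measurable_funM.
have Qd := tilted_density E01 Ls.
have QP := has_density_null measurableT mh Qd.
rewrite (integral_logE E01 QP) in mc.
have iX : (tilted_law E s).-integrable setT (EFin \o X).
  by apply: integrable_fin_integral => //; [exact: measfun_EFin|rewrite mc].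
have adm : admissible E c (tilted_law E s).
  by apply: (admissible_integrable E01 QP iX); rewrite mc.
have KLE : KL (tilted_law E s) P = (- s * c - l)%:E.
  have [-> _] := KL_has_density measurableT mh Qd.
  rewrite (_ : (fun x => (- s * X x - l)%:E) =
      (fun x => (- s)%:E * (X x)%:E - l%:E)); last exact/funext.
  rewrite integralB//; last 2 first.
  - exact: (integrableZl measurableT).
  - exact: finite_measure_integrable_cst.
  by rewrite integralZl// prob_integral_cst mc.
have DE : Dinf E c = KL (tilted_law E s) P.
  apply/eqP; rewrite eq_le Dinf_le_KL//= KLE.
  by rewrite (le_trans (Jsup_ge c s0 Ls))// Jsup_le_Dinf.
split => //; last by rewrite KLE Ls EFinB.
split => // Q [[QPc _ Qc] KLQ].
apply: has_density_unique Qd.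
rewrite (integral_logE E01 QPc) in Qc.
by have [_] := dual_bound mX QPc s0 Zl Qc; apply; rewrite KLQ DE.
Qed.

(** Slackness: a mean below [c] would satisfy the constraint at a smaller [c'] too, where the dual
    bound at [s] exceeds the value attained unless [s = 0]; but [s = 0] gives the value 0, against
    its strict positivity. *)
Lemma minimizer_tilted Q : 0 < s_max E -> minimizer E c Q ->
  exists s : R, [/\ (0 <= s)%R, Lambda E s < +oo & tilted_mean E s = c%:E].
Proof.
move=> sm0 [[QP Qdef Qc] KLQ].
have [s [l [s0 Ls DE JD]]] := strong_duality E01 mu_gtNy cmu x0c.
have [l' Ll' Zl] : exists2 l', Lambda E s = l'%:E &
    \int[P]_x (expR (- s * X x))%:E = (expR l')%:E.
  by apply: (Lambda_fin E01); rewrite Ls ltry.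
move: Ll'; rewrite Ls => -[ll']; rewrite -{l'}ll' in Zl.
rewrite (integral_logE E01 QP) in Qc.
have [_] := dual_bound mX QP s0 Zl Qc; rewrite KLQ DE => /(_ erefl) Qd.
exists s; split => //; first by rewrite Ls ltry.
have -> : tilted_mean E s = \int[Q]_x (X x)%:E.
  rewrite /tilted_mean -(integral_logE E01 QP); apply: eq_measure_integral => B mB _.
  exact: has_density_unique (tilted_density E01 Ls) Qd _ mB.
apply/eqP; rewrite eq_le Qc/= leNgt; apply/negP => Qltc.
(* The mean under [Q] may be [-oo] at this point, so a real level below [c] is chosen in each
   case. *)
have [c' Qc' c'c] : exists2 c' : R, \int[Q]_x (X x)%:E <= c'%:E & (c' < c)%R.
  move: Qltc; case: integral => [r| |]//.
    by rewrite lte_fin => rc; exists r.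
  by move=> _; exists (c - 1)%R; [exact: leNye|rewrite ltrBlDr ltrDl].
have [+ _] := dual_bound mX QP s0 Zl Qc'.
rewrite KLQ DE lee_fin lerD2r !mulNr lerN2 => scc.
have s_eq0 : s = 0%R.
  apply/eqP; rewrite eq_le s0 andbT leNgt; apply/negP => s_gt0.
  by move: scc; rewrite ler_pM2l// leNgt c'c.
have := Jsup_gt0 E01 mu_gtNy cmu sm0; rewrite JD DE.
move: Ls; rewrite s_eq0 Lambda0// => -[<-].
by rewrite oppr0 mul0r addr0 ltxx.
Qed.

End between.

End regimes.

Unset Implicit Arguments.

Theorem proposition3p8 (d : measure_display) (T : measurableType d)
    (R : realType) (P : probability T R) (E : {RV P >-> \bar R})
    (E_pos_fin : P [set x | 0 < E x < +oo] = 1)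
    (mu_defined : expectation_defined P (logE E))
    (mu_gtNy : -oo < \int[P]_x logE E x) :
  let mu := \int[P]_x logE E x in
  [/\ forall s : R, (0 <= s)%R -> -oo < Lambda E s,
      x0 E < +oo &
      forall c : R, Jsup E c = Dinf E c]
  /\
  [/\ (* a *)
      forall c : R, mu <= c%:E ->
        [/\ Jsup E c = 0, Dinf E c = 0 & minimizer E c P],
      (* b *)
      forall c : R, c%:E < x0 E ->
        [/\ admissible E c = set0, Jsup E c = +oo & Dinf E c = +oo],
      (* c *)
      forall c : R, c%:E = x0 E ->
        [/\ Jsup E c = lne (1 / P (x0_event E)),
            Dinf E c = lne (1 / P (x0_event E)),
            (exists Q, minimizer E c Q) <-> 0 < P (x0_event E) &
            0 < P (x0_event E) -> unique_minimizer E c (x0_law E)],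
      (* d *)
      forall c : R, x0 E < c%:E -> c%:E < mu -> s_max E = 0 ->
        [/\ Jsup E c = 0, Dinf E c = 0 & ~ exists Q, minimizer E c Q] &
      (* e *)
      forall c : R, x0 E < c%:E -> c%:E < mu -> 0 < s_max E ->
        [/\ 0 < Jsup E c, 0 < Dinf E c,
            (exists Q, minimizer E c Q) <->
            (exists s : R,
               [/\ (0 <= s)%R, Lambda E s < +oo & tilted_mean E s = c%:E]) &
            forall s : R,
              (0 <= s)%R -> Lambda E s < +oo -> tilted_mean E s = c%:E ->
              [/\ unique_minimizer E c (tilted_law E s),
                  Dinf E c = KL (tilted_law E s) P &
                  KL (tilted_law E s) P = (- s * c)%:E - Lambda E s]]].
Proof.
move=> mu; rewrite /mu.
have below c : c%:E < x0 E -> exists2 b : R, x0 E = b%:E & (c < b)%R.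
  have := x0_lty E_pos_fin; case: (x0 E) => [r| |]// _.
  by rewrite lte_fin => cr; exists r.
split; [split|split].
- by move=> s _; exact: Lambda_gtNy.
- exact: x0_lty.
- move=> c; have [cx0|x0c|/esym cx0] := ltgtP (c%:E) (x0 E).
  + by have [b bE /(duality_below_x0 E_pos_fin bE)[_ -> ->]] := below c cx0.
  + have [muc|cmu] := leP (\int[P]_x logE E x) c%:E.
      by have [-> ->] := minimizer_above_mean E_pos_fin mu_defined muc.
    by have [s [l []]] := strong_duality E_pos_fin mu_gtNy cmu x0c.
  + by have [-> ->] := duality_x0 E_pos_fin cx0.
- by move=> c; exact: minimizer_above_mean.
- move=> c cx0; have [b bE] := below c cx0.
  exact: (duality_below_x0 E_pos_fin bE).
- by move=> c /esym; exact: duality_x0.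
- by move=> c; exact: duality_no_tilt.
- move=> c x0c cmu sm0.
  have J0 := Jsup_gt0 E_pos_fin mu_gtNy cmu sm0.
  split => //.
  + exact: lt_le_trans (Jsup_le_Dinf E_pos_fin c).
  + split=> [[Q]|[s [s0 Ls mc]]].
      exact: minimizer_tilted.
    exists (tilted_law E s).
    by have [[]] := tilted_minimizer E_pos_fin s0 Ls mc.
  + by move=> s; exact: tilted_minimizer.
Qed.
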